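(* Let $X$ be a Banach space with norm $\|\cdot\|$, let $\mathbb{C}_+=\{z\in\mathbb{C}:\operatorname{Re}(z)>0\}$, and let $F:\mathbb{C}_+\to X$ be a holomorphic function such that for some $a_1,a_2,a_3>0$ and $\beta_1,\beta_2,\beta_3\ge 0$ one has $$\|F(|z|e^{i\theta})\|\le a_1(|z|\cos\theta)^{-\beta_1}$$ and $$\|F(|z|)\|\le a_1|z|^{-\beta_1}\left(\frac{a_2}{|z|}\right)^{-\beta_2}\left(\frac{a_3}{|z|}\right)^{\beta_3}$$ for all $|z|>0$ and all $|\theta|<\pi/2$. Then for all $\epsilon\in(0,1)$, all $|z|>0$ and all $|\theta|<\pi/2$ one has $$\|F(|z|e^{i\theta})\|\le a_1(|z|\cos\theta)^{-\beta_1}\left[1\wedge \epsilon^{-\beta_1}\left(\left(\frac{a_2}{|z|}\right)^{-\beta_2}\left(\frac{a_3}{|z|}\right)^{\beta_3}\right)^{1-|\theta|/\gamma(\epsilon,\theta)}\right],$$ where $\gamma(\epsilon,\theta):=\epsilon|\theta|+(1-\epsilon)\pi/2$.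
   Context: Notation: $A\wedge B:=\min\{A,B\}$. The Banach space is over $\mathbb{C}$ (so that holomorphy makes sense). *)

(* Defs.v *)
From Stdlib Require Import Reals.
From Coquelicot Require Import Coquelicot.

Open Scope R_scope.

Definition right_half_plane (z : C) : Prop := 0 < Re z.

(* For open [D], the only case of interest, this depends only on the
   restriction of [F] to [D]: [ex_derive] over [C_AbsRing] is complex
   differentiability, and it is local. *)
Definition holomorphic_on (X : NormedModule C_AbsRing)
    (D : C -> Prop) (F : C -> X) : Prop :=
  forall z : C, D z -> ex_derive (K := C_AbsRing) (V := X) F z.

(* [r * e^(i * theta)] *)
Definition polar (r theta : R) : C := (RtoC r * (cos theta, sin theta))%C.

Definition gamma (eps theta : R) : R :=
  eps * Rabs theta + (1 - eps) * (PI / 2).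

(* Main.v *)
Require Import Defs.
From Stdlib Require Import Reals Lra Lia List Classical ClassicalEpsilon.
From Coquelicot Require Import Coquelicot.
Open Scope R_scope.

(** The statement is a three lines theorem in a sector. Fix the angle [theta], say
    nonnegative, and consider the sector between the real axis and the ray at the larger
    angle [gamma eps theta]. In the coordinate [w = ln z = s + i phi] the sector is a strip,
    and [G w = exp (beta1 w) F (exp w)] is bounded on the closed strip by
    [A = a1 (cos gamma) ^ (- beta1)]; on the real axis it is even bounded by
    [A exp (L + d s)], where [exp (L + d s)] is the bracket of the theorem. The function
    [(1 - phi / gamma) (L + d s)] is harmonic, so interpolation between the two sides of
    the strip ([three_lines]) gives the bound [A exp ((1 - phi / gamma) (L + d s))]. At
    [phi = theta] this is the claim, up to the comparison of [cos gamma] with [cos theta]: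
    [gamma] is chosen so that the angle left to the imaginary axis shrinks by the factor
    [eps], whence [cos gamma >= eps cos theta] by concavity ([cos_gamma_ge]).

    Three lines follows, as usual, from the maximum principle on rectangles for the norm of
    a holomorphic function ([maximum_principle]), here with values in a Banach space and
    assuming nothing but differentiability at each point. Its proof avoids the Cauchy
    integral formula. Bisection gives the theorem of Goursat for rectangles
    ([goursat_rectangle]) and thus a primitive. At every point the primitive has a second
    order expansion, hence equals its mean over the four neighbours at distance [h] up to
    [o(h ^ 2)] ([primitive_harmonic]). For the norm of a function with this property the
    maximum principle is elementary: after adding a small multiple of [s ^ 2], an interior
    maximum contradicts the mean inequality ([discrete_max_principle]). The property passes
    to the difference quotients of the primitive, which converge uniformly on rectangles to
    the original function. *)

(** * Identities between linear combinations of vectors *)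

(** Formal linear combinations with complex coefficients. Two of them have the same
    value in every module as soon as each vector has the same coefficient in both;
    the tactic [vector] uses this to turn an identity between vectors into one
    identity between complex numbers for each vector, within reach of [ring]. *)
Inductive vexpr : Set :=
  | VZero
  | VAtom (n : nat)
  | VPlus (e1 e2 : vexpr)
  | VMinus (e1 e2 : vexpr)
  | VOpp (e : vexpr)
  | VScal (c : C) (e : vexpr).

Fixpoint veval {X : ModuleSpace C_AbsRing} (env : list X) (e : vexpr) : X :=
  match e with
  | VZero => zero
  | VAtom n => nth n env zero
  | VPlus e1 e2 => plus (veval env e1) (veval env e2)
  | VMinus e1 e2 => minus (veval env e1) (veval env e2)
  | VOpp e => opp (veval env e)
  | VScal c e => scal (c : C_AbsRing) (veval env e)
  end.

Fixpoint vcoef (e : vexpr) (n : nat) : C :=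
  match e with
  | VZero => 0%C
  | VAtom m => if Nat.eqb m n then 1%C else 0%C
  | VPlus e1 e2 => (vcoef e1 n + vcoef e2 n)%C
  | VMinus e1 e2 => (vcoef e1 n - vcoef e2 n)%C
  | VOpp e => (- vcoef e n)%C
  | VScal c e => (c * vcoef e n)%C
  end.

Fixpoint lincomb {X : ModuleSpace C_AbsRing} (env : list X) (c : nat -> C) : X :=
  match env with
  | nil => zero
  | v :: env' => plus (scal (c O : C_AbsRing) v) (lincomb env' (fun n => c (S n)))
  end.

Lemma lincomb_ext {X : ModuleSpace C_AbsRing} (env : list X) (c d : nat -> C) :
  (forall n, (n < length env)%nat -> c n = d n) -> lincomb env c = lincomb env d.
Proof.
  revert c d; induction env as [|v env IH]; intros c d Hcd; [reflexivity|].
  simpl; f_equal.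
  - now rewrite (Hcd O) by (simpl; lia).
  - apply IH; intros n Hn; apply Hcd; simpl; lia.
Qed.

Lemma lincomb_zero {X : ModuleSpace C_AbsRing} (env : list X) :
  lincomb env (fun _ => 0%C) = zero.
Proof.
  induction env as [|v env IH]; [reflexivity|]; simpl; rewrite IH.
  change (RtoC 0) with (@zero (AbsRing.Ring C_AbsRing)); now rewrite scal_zero_l, plus_zero_l.
Qed.

Lemma lincomb_atom {X : ModuleSpace C_AbsRing} (env : list X) (m : nat) :
  lincomb env (fun n => if Nat.eqb m n then 1%C else 0%C) = nth m env zero.
Proof.
  revert m; induction env as [|v env IH]; intros [|m]; simpl; try reflexivity.
  - rewrite lincomb_zero.
    change (RtoC 1) with (@one (AbsRing.Ring C_AbsRing)); now rewrite scal_one, plus_zero_r.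
  - rewrite IH; change (RtoC 0) with (@zero (AbsRing.Ring C_AbsRing)).
    now rewrite scal_zero_l, plus_zero_l.
Qed.

Lemma plus_swap_inner {G : AbelianMonoid} (a b c d : G) :
  plus (plus a b) (plus c d) = plus (plus a c) (plus b d).
Proof.
  now rewrite <- 2!plus_assoc, (plus_assoc b c d), (plus_comm b c), <- (plus_assoc c b d).
Qed.

Lemma lincomb_plus {X : ModuleSpace C_AbsRing} (env : list X) (c d : nat -> C) :
  lincomb env (fun n => (c n + d n)%C) = plus (lincomb env c) (lincomb env d).
Proof.
  revert c d; induction env as [|v env IH]; intros c d; simpl.
  - now rewrite plus_zero_l.
  - rewrite IH; change (c 0%nat + d 0%nat)%C
      with (@plus (AbsRing.Ring C_AbsRing) (c 0%nat) (d 0%nat)).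
    rewrite scal_distr_r; apply plus_swap_inner.
Qed.

Lemma lincomb_scal {X : ModuleSpace C_AbsRing} (env : list X) (a : C) (c : nat -> C) :
  lincomb env (fun n => (a * c n)%C) = scal (a : C_AbsRing) (lincomb env c).
Proof.
  revert c; induction env as [|v env IH]; intros c; simpl.
  - now rewrite scal_zero_r.
  - rewrite IH, scal_distr_l, scal_assoc; reflexivity.
Qed.

Lemma veval_lincomb {X : ModuleSpace C_AbsRing} (env : list X) (e : vexpr) :
  veval env e = lincomb env (vcoef e).
Proof.
  assert (Hopp : forall c, opp (lincomb env c) = lincomb env (fun n => (- c n)%C)).
  { intros c; rewrite <- scal_opp_one, <- (lincomb_scal env (@opp (AbsRing.Ring C_AbsRing) one)).
    apply lincomb_ext; intros n _; change (- (1) * c n = - c n)%C; ring. }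
  induction e as [|n|e1 IH1 e2 IH2|e1 IH1 e2 IH2|e IH|c e IH]; simpl.
  - symmetry; apply lincomb_zero.
  - symmetry; apply lincomb_atom.
  - now rewrite IH1, IH2, <- lincomb_plus.
  - rewrite IH1, IH2; unfold minus; rewrite Hopp.
    exact (eq_sym (lincomb_plus env _ _)).
  - now rewrite IH, Hopp.
  - now rewrite IH, <- lincomb_scal.
Qed.

Lemma veval_eq {X : CompleteNormedModule C_AbsRing} (env : list X) (e1 e2 : vexpr) :
  (forall n, (n < length env)%nat -> vcoef e1 n = vcoef e2 n) ->
  veval env e1 = veval env e2.
Proof. intros H; rewrite !veval_lincomb; now apply lincomb_ext. Qed.

Ltac vindex v env :=
  lazymatch env with
  | v :: _ => constr:(O)
  | _ :: ?env' => let n := vindex v env' in constr:(S n)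
  end.

Ltac vreify env t :=
  match t with
  | plus ?a ?b => let x := vreify env a in let y := vreify env b in constr:(VPlus x y)
  | minus ?a ?b => let x := vreify env a in let y := vreify env b in constr:(VMinus x y)
  | opp ?a => let x := vreify env a in constr:(VOpp x)
  | scal ?c ?a => let x := vreify env a in constr:(VScal c x)
  | zero => constr:(VZero)
  | _ => let n := vindex t env in constr:(VAtom n)
  end.

Ltac vcollect t env :=
  match t with
  | plus ?a ?b => let e := vcollect a env in vcollect b e
  | minus ?a ?b => let e := vcollect a env in vcollect b e
  | opp ?a => vcollect a env
  | scal ?c ?a => vcollect a env
  | zero => env
  | _ => match env with
         | context [t] => env
         | _ => constr:(t :: env)
         end
  end.

Ltac vector :=
  lazymatch goal with
  | X : CompleteNormedModule C_AbsRing |- ?a = ?b =>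
    let env0 := vcollect a (@nil (CompleteNormedModule.sort _ X)) in
    let env := vcollect b env0 in
    let x := vreify env a in
    let y := vreify env b in
    refine (veval_eq (X := X) env x y _);
    let n := fresh in let Hn := fresh in
    intros n Hn;
    repeat (first [ exfalso; simpl in Hn; lia
                  | destruct n as [|n]; [clear Hn; simpl|] ])
  end.

(** * Norm inequalities *)

Lemma norm_plus_le {X : CompleteNormedModule C_AbsRing} (u v : X) :
  norm (plus u v) <= norm u + norm v.
Proof. exact (norm_triangle u v). Qed.

Lemma norm_scal_le {X : CompleteNormedModule C_AbsRing} (c : C) (v : X) :
  norm (scal c v) <= Cmod c * norm v.
Proof. exact (norm_scal (V := X) c v). Qed.

Lemma norm_minus_le {X : CompleteNormedModule C_AbsRing} (u v : X) :
  norm (minus u v) <= norm u + norm v.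
Proof. rewrite <- (norm_opp v); exact (norm_triangle u (opp v)). Qed.

Lemma norm_le_minus {X : CompleteNormedModule C_AbsRing} (u v : X) :
  norm u <= norm v + norm (minus u v).
Proof.
  replace u with (plus v (minus u v)) at 1 by (vector; ring); apply norm_plus_le.
Qed.

Lemma norm_scal_Ci {X : CompleteNormedModule C_AbsRing} (v : X) :
  norm (scal Ci v) <= norm v.
Proof.
  apply Rle_trans with (1 := norm_scal_le Ci v); rewrite Cmod_Ci; lra.
Qed.

Lemma norm_scal_pos {X : CompleteNormedModule C_AbsRing} (c : R) (v : X) :
  0 < c -> norm (scal (RtoC c) v) = c * norm v.
Proof.
  intros Hc; apply Rle_antisym.
  - apply Rle_trans with (1 := norm_scal_le _ _); rewrite Cmod_R, Rabs_pos_eq; lra.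
  - replace v with (scal (RtoC (/ c)) (scal (RtoC c) v)) at 1.
    + apply Rle_trans with (c * (/ c * norm (scal (RtoC c) v))).
      * apply Rmult_le_compat_l; [lra|].
        apply Rle_trans with (1 := norm_scal_le _ _).
        rewrite Cmod_R, Rabs_pos_eq; [lra|left; now apply Rinv_0_lt_compat].
      * right; field; lra.
    + vector; rewrite RtoC_inv by lra; field.
      intros E; apply RtoC_inj in E; lra.
Qed.

Lemma Cmod_le_sum (z : C) : Cmod z <= Rabs (Re z) + Rabs (Im z).
Proof.
  replace z with (RtoC (Re z) + Ci * RtoC (Im z))%C at 1.
  - apply Rle_trans with (1 := Cmod_triangle _ _).
    rewrite Cmod_mult, Cmod_Ci, !Cmod_R; lra.
  - apply injective_projections; unfold Re, Im; simpl; ring.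
Qed.

(** * Integrals of vector-valued functions over real intervals *)

(** Restriction of scalars: the carrier, norm and uniform structure of [X] with real
    scalars acting through [RtoC]. It makes the theory of the Riemann integral over
    real intervals, including integrability of continuous functions, apply to
    functions with values in [X]. *)
Definition real_scal {X : CompleteNormedModule C_AbsRing} (r : R) (v : X) : X :=
  scal (RtoC r) v.

Definition real_ModuleSpace_mixin (X : CompleteNormedModule C_AbsRing) :
  ModuleSpace.mixin_of R_Ring (CompleteNormedModule.AbelianGroup C_AbsRing X).
Proof.
  apply (ModuleSpace.Mixin R_Ring (CompleteNormedModule.AbelianGroup C_AbsRing X)
           (@real_scal X)); unfold real_scal.
  - intros x y u; change (mult x y) with (x * y); rewrite RtoC_mult.
    exact (scal_assoc (V := X) (RtoC x) (RtoC y) u).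
  - intros u; exact (scal_one (V := X) u).
  - intros x u v; exact (scal_distr_l (V := X) (RtoC x) u v).
  - intros x y u; change (plus x y) with (x + y); rewrite RtoC_plus.
    exact (scal_distr_r (V := X) (RtoC x) (RtoC y) u).
Defined.

Definition real_NormedModuleAux (X : CompleteNormedModule C_AbsRing) :
  NormedModuleAux R_AbsRing :=
  NormedModuleAux.Pack R_AbsRing X
    (NormedModuleAux.Class R_AbsRing X
       (ModuleSpace.Class R_Ring X
          (AbelianGroup.class (CompleteNormedModule.AbelianGroup C_AbsRing X))
          (real_ModuleSpace_mixin X))
       (UniformSpace.class (CompleteNormedModule.UniformSpace C_AbsRing X))) X.

Definition real_NormedModule_mixin (X : CompleteNormedModule C_AbsRing) :
  NormedModule.mixin_of R_AbsRing (real_NormedModuleAux X).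
Proof.
  apply (NormedModule.Mixin R_AbsRing (real_NormedModuleAux X)
           (fun v => norm (v : X)) (norm_factor (V := X))).
  - exact (norm_triangle (V := X)).
  - intros l x; change (abs l) with (Rabs l); rewrite <- (Cmod_R l).
    exact (norm_scal (V := X) (RtoC l) x).
  - exact (norm_compat1 (V := X)).
  - exact (norm_compat2 (V := X)).
  - exact (norm_eq_zero (V := X)).
Defined.

Definition real_CompleteNormedModule (X : CompleteNormedModule C_AbsRing) :
  CompleteNormedModule R_AbsRing :=
  CompleteNormedModule.Pack R_AbsRing X
    (CompleteNormedModule.Class R_AbsRing X
       (NormedModule.Class R_AbsRing X _ (real_NormedModule_mixin X))
       (CompleteSpace.mixin _
         (CompleteSpace.class (CompleteNormedModule.CompleteSpace C_AbsRing X)))) X.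

Definition vint {X : CompleteNormedModule C_AbsRing} (f : R -> X) (a b : R) : X :=
  RInt (V := real_CompleteNormedModule X) f a b.
Definition vintegrable {X : CompleteNormedModule C_AbsRing} (f : R -> X) (a b : R) :=
  ex_RInt (V := real_CompleteNormedModule X) f a b.

Lemma vintegrable_continuous {X : CompleteNormedModule C_AbsRing} (f : R -> X) (a b : R) :
  (forall t, Rmin a b <= t <= Rmax a b -> continuous f t) -> vintegrable f a b.
Proof. exact (ex_RInt_continuous (V := real_CompleteNormedModule X) f a b). Qed.

Lemma vint_plus {X : CompleteNormedModule C_AbsRing} (f g : R -> X) (a b : R) :
  vintegrable f a b -> vintegrable g a b ->
  vint (fun t => plus (f t) (g t)) a b = plus (vint f a b) (vint g a b).
Proof. exact (RInt_plus (V := real_CompleteNormedModule X) f g a b). Qed.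

Lemma vint_minus {X : CompleteNormedModule C_AbsRing} (f g : R -> X) (a b : R) :
  vintegrable f a b -> vintegrable g a b ->
  vint (fun t => minus (f t) (g t)) a b = minus (vint f a b) (vint g a b).
Proof. exact (RInt_minus (V := real_CompleteNormedModule X) f g a b). Qed.

Lemma vint_Chasles {X : CompleteNormedModule C_AbsRing} (f : R -> X) (a b c : R) :
  vintegrable f a b -> vintegrable f b c ->
  plus (vint f a b) (vint f b c) = vint f a c.
Proof. exact (RInt_Chasles (V := real_CompleteNormedModule X) f a b c). Qed.

Lemma vint_const {X : CompleteNormedModule C_AbsRing} (a b : R) (v : X) :
  vint (fun _ => v) a b = scal (RtoC (b - a)) v.
Proof. exact (RInt_const (V := real_CompleteNormedModule X) a b v). Qed.

Lemma vint_norm_le {X : CompleteNormedModule C_AbsRing} (f : R -> X) (a b M : R) :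
  a <= b -> vintegrable f a b -> (forall t, a <= t <= b -> norm (f t) <= M) ->
  norm (vint f a b) <= (b - a) * M.
Proof.
  intros Hab Hf HM.
  exact (norm_RInt_le_const (V := real_CompleteNormedModule X) f a b _ M Hab HM
           (RInt_correct (V := real_CompleteNormedModule X) f a b Hf)).
Qed.

Lemma vint_swap {X : CompleteNormedModule C_AbsRing} (f : R -> X) (a b : R) :
  vintegrable f a b -> vint f b a = opp (vint f a b).
Proof.
  intros Hf.
  apply (is_RInt_unique (V := real_CompleteNormedModule X)), 
    (is_RInt_swap (V := real_CompleteNormedModule X)).
  exact (RInt_correct (V := real_CompleteNormedModule X) f a b Hf).
Qed.

Lemma vint_norm_le_abs {X : CompleteNormedModule C_AbsRing} (f : R -> X) (a b M : R) :
  vintegrable f a b -> (forall t, Rmin a b <= t <= Rmax a b -> norm (f t) <= M) ->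
  norm (vint f a b) <= Rabs (b - a) * M.
Proof.
  intros Hf HM; destruct (Rle_dec a b) as [Hab|Hab].
  - rewrite Rabs_pos_eq by lra; apply vint_norm_le; auto.
    intros t Ht; apply HM; rewrite Rmin_left, Rmax_right; lra.
  - rewrite Rabs_left1 by lra.
    assert (Hf' : vintegrable f b a)
      by exact (ex_RInt_swap (V := real_CompleteNormedModule X) f a b Hf).
    rewrite (vint_swap f b a Hf').
    replace (norm (opp (vint f b a))) with (norm (vint f b a))
      by (symmetry; exact (norm_opp (V := X) _)).
    replace (- (b - a)) with (a - b) by ring; apply vint_norm_le; [lra|assumption|].
    intros t Ht; apply HM; rewrite Rmin_right, Rmax_left; lra.
Qed.

Lemma vint_shift {X : CompleteNormedModule C_AbsRing} (f : R -> X) (x h : R) :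
  vintegrable f x (x + h) ->
  vintegrable (fun t => f (x + t)) 0 h /\ vint (fun t => f (x + t)) 0 h = vint f x (x + h).
Proof.
  intros Hf.
  enough (H : is_RInt (V := real_CompleteNormedModule X)
                (fun t => f (x + t)) 0 h (vint f x (x + h))).
  { split; [eexists; exact H|].
    exact (is_RInt_unique (V := real_CompleteNormedModule X) _ _ _ _ H). }
  eapply (is_RInt_ext (V := real_CompleteNormedModule X)).
  2: apply (is_RInt_comp_lin (V := real_CompleteNormedModule X) f 1 x).
  - intros t _; transitivity (f (1 * t + x)); [exact (scal_one (V := X) _)|f_equal; ring].
  - replace (1 * 0 + x) with x by ring; replace (1 * h + x) with (x + h) by ring.
    exact (RInt_correct (V := real_CompleteNormedModule X) f _ _ Hf).
Qed.

Lemma vint_reflect {X : CompleteNormedModule C_AbsRing} (f : R -> X) (x h : R) :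
  vintegrable f (x - h) x ->
  vintegrable (fun t => f (x - t)) 0 h /\ vint (fun t => f (x - t)) 0 h = vint f (x - h) x.
Proof.
  intros Hf.
  enough (H : is_RInt (V := real_CompleteNormedModule X)
                (fun t => f (x - t)) 0 h (vint f (x - h) x)).
  { split; [eexists; exact H|].
    exact (is_RInt_unique (V := real_CompleteNormedModule X) _ _ _ _ H). }
  replace (vint f (x - h) x) with (opp (opp (vint f (x - h) x)))
    by apply opp_opp.
  rewrite <- (vint_swap _ _ _ Hf).
  eapply (is_RInt_ext (V := real_CompleteNormedModule X)).
  2: apply (is_RInt_opp (V := real_CompleteNormedModule X)).
  2: apply (is_RInt_comp_lin (V := real_CompleteNormedModule X) f (-1) x).
  - intros t _; simpl.
    transitivity (opp (scal (RtoC (-1)) (f (-1 * t + x)))); [reflexivity|].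
    replace (f (x - t)) with (f (-1 * t + x)) by (f_equal; ring).
    assert (H1 : RtoC (-1) = (- (1))%C)
      by (unfold RtoC, Copp; simpl; f_equal; ring).
    rewrite H1; vector; ring.
  - replace (-1 * 0 + x) with x by ring; replace (-1 * h + x) with (x - h) by ring.
    rewrite (vint_swap _ _ _ Hf).
    apply (is_RInt_swap (V := real_CompleteNormedModule X)).
    exact (RInt_correct (V := real_CompleteNormedModule X) f _ _ Hf).
Qed.

(** * Complex differentiability *)

Lemma continuous_hline {X : CompleteNormedModule C_AbsRing} (f : C -> X) (x y : R) :
  ex_derive (K := C_AbsRing) f (x, y) -> continuous (fun t => f (t, y)) x.
Proof.
  intros Hf.
  apply (continuous_comp (V := AbsRing_UniformSpace C_AbsRing)
           (fun t : R => (t, y) : C) f).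
  2: exact (ex_derive_continuous f _ Hf).
  apply filterlim_locally; intros eps; exists eps; intros t Ht.
  change (Cmod (minus (t, y) (x, y) : C) < eps).
  replace (minus (t, y) (x, y) : C) with (RtoC (t - x)).
  - rewrite Cmod_R; exact Ht.
  - symmetry; change ((t, y) - (x, y) = RtoC (t - x))%C.
    apply injective_projections; simpl; ring.
Qed.

Lemma continuous_vline {X : CompleteNormedModule C_AbsRing} (f : C -> X) (x y : R) :
  ex_derive (K := C_AbsRing) f (x, y) -> continuous (fun t => f (x, t)) y.
Proof.
  intros Hf.
  apply (continuous_comp (V := AbsRing_UniformSpace C_AbsRing)
           (fun t : R => (x, t) : C) f).
  2: exact (ex_derive_continuous f _ Hf).
  apply filterlim_locally; intros eps; exists eps; intros t Ht.
  change (Cmod (minus (x, t) (x, y) : C) < eps).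
  replace (minus (x, t) (x, y) : C) with (Ci * RtoC (t - y))%C.
  - rewrite Cmod_mult, Cmod_Ci, Cmod_R, Rmult_1_l; exact Ht.
  - symmetry; change ((x, t) - (x, y) = Ci * RtoC (t - y))%C.
    apply injective_projections; simpl; ring.
Qed.

Lemma derive_first_order {X : CompleteNormedModule C_AbsRing} (f : C -> X) (z : C) (l : X) :
  is_derive (K := C_AbsRing) f z l ->
  forall eps, 0 < eps -> exists delta, 0 < delta /\ forall w : C, Cmod (w - z) < delta ->
    norm (minus (minus (f w) (f z)) (scal (w - z)%C l)) <= eps * Cmod (w - z).
Proof.
  intros [_ Hd] eps Heps.
  destruct (Hd z (fun P HP => HP) (mkposreal eps Heps)) as [delta Hdelta].
  exists delta; split; [apply cond_pos|]; intros w Hw; exact (Hdelta w Hw).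
Qed.

(** The differential is the multiplication by [l], so the little-o estimate at [z]
    is all that differentiability says. *)
Lemma first_order_derive {X : NormedModule C_AbsRing} (f : C -> X) (z : C) (l : X) :
  (forall eps, 0 < eps -> exists delta, 0 < delta /\ forall w : C, Cmod (w - z) < delta ->
    norm (minus (minus (f w) (f z)) (scal (w - z)%C l)) <= eps * Cmod (w - z)) ->
  is_derive (K := C_AbsRing) f z l.
Proof.
  intros H; split; [apply is_linear_scal_l|].
  intros x Hx; rewrite <- (is_filter_lim_locally_unique _ _ Hx); intros eps.
  destruct (H eps (cond_pos eps)) as [delta [Hpos Hdelta]].
  exists (mkposreal delta Hpos); intros w Hw; exact (Hdelta w Hw).
Qed.

Lemma ex_derive_near {X : CompleteNormedModule C_AbsRing} (f : C -> X) (z : C) :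
  ex_derive (K := C_AbsRing) f z -> forall eps, 0 < eps ->
  exists delta, 0 < delta /\ forall w, Cmod (w - z) < delta ->
    norm (minus (f w) (f z)) < eps.
Proof.
  intros [l Hl] eps Heps.
  destruct (derive_first_order f z l Hl 1 Rlt_0_1) as [d [Hd Hfo]].
  assert (Hn := norm_ge_0 (V := X) l).
  exists (Rmin d (eps / (1 + norm l))); split.
  { apply Rmin_pos; [assumption|apply Rdiv_lt_0_compat; lra]. }
  intros w Hw.
  assert (H1 := Rlt_le_trans _ _ _ Hw (Rmin_l _ _)).
  assert (H2 := Rlt_le_trans _ _ _ Hw (Rmin_r _ _)).
  replace (minus (f w) (f z)) with
    (plus (minus (minus (f w) (f z)) (scal (w - z)%C l)) (scal (w - z)%C l))
    by (vector; ring).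
  apply Rle_lt_trans with (1 := norm_plus_le _ _).
  apply Rle_lt_trans with (1 * Cmod (w - z) + Cmod (w - z) * norm l).
  - apply Rplus_le_compat; [exact (Hfo w H1)|apply norm_scal_le].
  - apply Rmult_lt_compat_r with (r := 1 + norm l) in H2; [|lra].
    replace (eps / (1 + norm l) * (1 + norm l)) with eps in H2 by (field; lra); lra.
Qed.

(** * Bisection of rectangles *)

Lemma div_pow2_small (s delta : R) :
  0 <= s -> 0 < delta -> exists n : nat, s / 2 ^ n < delta.
Proof.
  intros Hs Hdelta.
  assert (Hpow : forall n, INR n <= 2 ^ n).
  { induction n as [|n IH]; [simpl; lra|].
    rewrite S_INR; assert (H1 := pow_R1_Rle 2 n ltac:(lra)); simpl; lra. }
  destruct (INR_archimed delta s Hdelta) as [n Hn].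
  exists n; assert (H2 : 0 < 2 ^ n) by (apply pow_lt; lra).
  apply Rmult_lt_reg_r with (2 ^ n); [assumption|].
  replace (s / 2 ^ n * 2 ^ n) with s by (field; lra).
  specialize (Hpow n); nra.
Qed.

Lemma div_pow2_ge_0 (a : R) (n : nat) : 0 <= a -> 0 <= a / 2 ^ n.
Proof.
  intros Ha; apply Rmult_le_pos; [assumption|].
  left; apply Rinv_0_lt_compat, pow_lt; lra.
Qed.

Lemma half_step (a : R) (n : nat) : a / 2 ^ n = 2 * (a / 2 ^ S n).
Proof. simpl; field; apply pow_nonzero; lra. Qed.

Lemma nested_intervals (x : nat -> R) (a : R) :
  0 <= a ->
  (forall n, x (S n) = x n \/ x (S n) = x n + a / 2 ^ S n) ->
  exists t, forall n, x n <= t <= x n + a / 2 ^ n /\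
    x O <= x n /\ x n + a / 2 ^ n <= x O + a.
Proof.
  intros Ha Hstep.
  assert (Hpos := fun n => div_pow2_ge_0 a n Ha).
  assert (Hmono : forall n m, x n <= x (n + m)%nat /\
            x (n + m)%nat + a / 2 ^ (n + m) <= x n + a / 2 ^ n).
  { intros n; induction m as [|m [IH1 IH2]]; [rewrite Nat.add_0_r; lra|].
    rewrite Nat.add_succ_r; rewrite (half_step a (n + m)) in IH2.
    specialize (Hpos (S (n + m))); destruct (Hstep (n + m)%nat) as [->| ->]; lra. }
  destruct (completeness (fun r => exists n, r = x n)) as [t [Hub Hlub]].
  - exists (x O + a); intros r [n ->].
    destruct (Hmono O n) as [_ H]; simpl in H; specialize (Hpos n); lra.
  - now exists (x O), O.
  - exists t; intros n; repeat split.
    + apply Hub; now exists n.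
    + apply Hlub; intros r [m ->].
      destruct (Nat.le_ge_cases n m) as [Hnm|Hnm].
      * replace m with (n + (m - n))%nat by lia.
        destruct (Hmono n (m - n)%nat) as [_ H].
        specialize (Hpos (n + (m - n))%nat); lra.
      * replace n with (m + (n - m))%nat by lia.
        destruct (Hmono m (n - m)%nat) as [H _].
        specialize (Hpos (m + (n - m))%nat); lra.
    + exact (proj1 (Hmono O n)).
    + destruct (Hmono O n) as [_ H]; simpl in H; lra.
Qed.

Lemma rectangle_bisection (P : nat -> R -> R -> Prop) (x0 y0 a b : R) :
  0 <= a -> 0 <= b -> P O x0 y0 ->
  (forall n x y, x0 <= x -> x + a / 2 ^ n <= x0 + a ->
     y0 <= y -> y + b / 2 ^ n <= y0 + b -> P n x y ->
     exists x' y', (x' = x \/ x' = x + a / 2 ^ S n) /\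
                   (y' = y \/ y' = y + b / 2 ^ S n) /\ P (S n) x' y') ->
  exists s t, x0 <= s <= x0 + a /\ y0 <= t <= y0 + b /\
    forall n, exists x y, P n x y /\
      x <= s <= x + a / 2 ^ n /\ y <= t <= y + b / 2 ^ n /\
      x0 <= x /\ x + a / 2 ^ n <= x0 + a /\ y0 <= y /\ y + b / 2 ^ n <= y0 + b.
Proof.
  intros Ha Hb H0 Hstep.
  set (inside := fun n x y => x0 <= x /\ x + a / 2 ^ n <= x0 + a /\
                              y0 <= y /\ y + b / 2 ^ n <= y0 + b).
  set (Q := fun n (p : R * R) => P n (fst p) (snd p) /\ inside n (fst p) (snd p)).
  set (rel := fun n (p p' : R * R) =>
     (fst p' = fst p \/ fst p' = fst p + a / 2 ^ S n) /\
     (snd p' = snd p \/ snd p' = snd p + b / 2 ^ S n)).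
  assert (Hnext : forall n (p : {p | Q n p}),
            exists p' : {p' | Q (S n) p'}, rel n (proj1_sig p) (proj1_sig p')).
  { intros n [[x y] [HP (H1 & H2 & H3 & H4)]]; cbn [fst snd proj1_sig] in *.
    destruct (Hstep n x y H1 H2 H3 H4 HP) as (x' & y' & Hx & Hy & HP').
    rewrite (half_step a n) in H2; rewrite (half_step b n) in H4.
    assert (Hpa := div_pow2_ge_0 a (S n) Ha); assert (Hpb := div_pow2_ge_0 b (S n) Hb).
    assert (HQ : Q (S n) (x', y')).
    { split; [exact HP'|]; unfold inside; simpl fst; simpl snd.
      destruct Hx as [->| ->], Hy as [->| ->]; lra. }
    exists (exist _ _ HQ); split; assumption. }
  assert (HQ0 : Q O (x0, y0)).
  { split; [exact H0|]; unfold inside; simpl; lra. }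
  set (next := fun n p => proj1_sig (constructive_indefinite_description _ (Hnext n p))).
  set (seq := fix seq n : {p | Q n p} :=
     match n with O => exist _ _ HQ0 | S m => next m (seq m) end).
  assert (Hrel : forall n, rel n (proj1_sig (seq n)) (proj1_sig (seq (S n)))).
  { intros n; simpl; unfold next.
    exact (proj2_sig (constructive_indefinite_description _ (Hnext n (seq n)))). }
  destruct (nested_intervals (fun n => fst (proj1_sig (seq n))) a Ha
              (fun n => proj1 (Hrel n))) as [s Hs].
  destruct (nested_intervals (fun n => snd (proj1_sig (seq n))) b Hb
              (fun n => proj2 (Hrel n))) as [t Ht].
  exists s, t; split; [|split].
  - specialize (Hs O); simpl in Hs; lra.
  - specialize (Ht O); simpl in Ht; lra.
  - intros n; exists (fst (proj1_sig (seq n))), (snd (proj1_sig (seq n))).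
    destruct (proj2_sig (seq n)) as [HP HI].
    specialize (Hs n); specialize (Ht n); unfold inside in HI; tauto.
Qed.

(** A property of rectangles that is inherited from the four quarters by the whole, and
    that holds for all small rectangles around each point, holds for the large rectangle:
    otherwise repeated quartering would produce bad rectangles shrinking to a point.
    The index [n] records that the sides are [a / 2 ^ n] and [b / 2 ^ n]. This one
    principle serves the theorem of Goursat, the extreme value theorem and a uniform
    continuity statement. *)
Lemma rectangle_induction (Q : nat -> R -> R -> Prop) (x0 y0 a b : R) :
  0 <= a -> 0 <= b ->
  (forall n x y, x0 <= x -> x + a / 2 ^ n <= x0 + a ->
     y0 <= y -> y + b / 2 ^ n <= y0 + b ->
     (forall x' y', x' = x \/ x' = x + a / 2 ^ S n ->
                    y' = y \/ y' = y + b / 2 ^ S n -> Q (S n) x' y') -> Q n x y) ->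
  (forall s t, x0 <= s <= x0 + a -> y0 <= t <= y0 + b ->
     exists delta, 0 < delta /\ forall n x y, a / 2 ^ n + b / 2 ^ n < delta ->
       x0 <= x -> x + a / 2 ^ n <= x0 + a -> y0 <= y -> y + b / 2 ^ n <= y0 + b ->
       x <= s <= x + a / 2 ^ n -> y <= t <= y + b / 2 ^ n -> Q n x y) ->
  Q O x0 y0.
Proof.
  intros Ha Hb Hstep Hloc; apply NNPP; intros HQ.
  destruct (rectangle_bisection (fun n x y => ~ Q n x y) x0 y0 a b Ha Hb HQ)
    as (s & t & Hs & Ht & HP).
  - intros n x y H1 H2 H3 H4 HnQ; apply NNPP; intros Hno; apply HnQ.
    apply Hstep; auto; intros x' y' Hx Hy; apply NNPP; intros HnQ'.
    apply Hno; now exists x', y'.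
  - destruct (Hloc s t Hs Ht) as [delta [Hdelta HQs]].
    destruct (div_pow2_small (a + b) delta ltac:(lra) Hdelta) as [n Hn].
    destruct (HP n) as (x & y & HnQ & H1 & H2 & H3 & H4 & H5 & H6).
    apply HnQ, HQs; auto.
    replace (a / 2 ^ n + b / 2 ^ n) with ((a + b) / 2 ^ n)
      by (field; apply pow_nonzero; lra); exact Hn.
Qed.

(** * The theorem of Goursat *)

Definition strip (H : R) (z : C) : Prop := Rabs (Im z) < H.

Definition horizontal_int {X : CompleteNormedModule C_AbsRing} (f : C -> X) (y a b : R) : X :=
  vint (fun t => f (t, y)) a b.

(** The factor [Ci] is the derivative of the vertical parametrization. It is kept under
    the integral sign, so that only real scalars ever leave an integral. *)
Definition vertical_int {X : CompleteNormedModule C_AbsRing} (f : C -> X) (x a b : R) : X :=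
  vint (fun t => scal Ci (f (x, t))) a b.

Lemma between_strip (H a b t : R) :
  Rabs a < H -> Rabs b < H -> Rmin a b <= t <= Rmax a b -> Rabs t < H.
Proof.
  intros Ha Hb [H1 H2]; apply Rabs_def1.
  - apply Rabs_def2 in Ha, Hb; apply Rle_lt_trans with (1 := H2).
    now apply Rmax_lub_lt.
  - apply Rabs_def2 in Ha, Hb; apply Rlt_le_trans with (2 := H1).
    now apply Rmin_glb_lt.
Qed.

Lemma horizontal_integrable {X : CompleteNormedModule C_AbsRing} (f : C -> X) (H y a b : R) :
  holomorphic_on X (strip H) f -> Rabs y < H -> vintegrable (fun t => f (t, y)) a b.
Proof.
  intros Hf Hy; apply vintegrable_continuous; intros t _.
  apply continuous_hline, Hf; exact Hy.
Qed.

Lemma vertical_integrable {X : CompleteNormedModule C_AbsRing} (f : C -> X) (H x a b : R) :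
  holomorphic_on X (strip H) f -> Rabs a < H -> Rabs b < H ->
  vintegrable (fun t => scal Ci (f (x, t))) a b.
Proof.
  intros Hf Ha Hb; apply vintegrable_continuous; intros t Ht.
  apply (continuous_scal_r Ci (fun t => f (x, t))).
  apply continuous_vline, Hf, (between_strip H a b); assumption.
Qed.

(** The integral of [f(z) dz] along the boundary of a rectangle, counterclockwise. *)
Definition circulation {X : CompleteNormedModule C_AbsRing} (f : C -> X)
    (x0 x1 y0 y1 : R) : X :=
  plus (minus (horizontal_int f y0 x0 x1) (horizontal_int f y1 x0 x1))
       (minus (vertical_int f x1 y0 y1) (vertical_int f x0 y0 y1)).

Lemma circulation_split {X : CompleteNormedModule C_AbsRing} (f : C -> X)
    (H x0 x1 x2 y0 y1 y2 : R) :
  holomorphic_on X (strip H) f -> Rabs y0 < H -> Rabs y1 < H -> Rabs y2 < H ->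
  circulation f x0 x2 y0 y2 =
  plus (plus (circulation f x0 x1 y0 y1) (circulation f x1 x2 y0 y1))
       (plus (circulation f x0 x1 y1 y2) (circulation f x1 x2 y1 y2)).
Proof.
  intros Hf H0 H1 H2; unfold circulation.
  assert (Hh : forall y, Rabs y < H ->
            horizontal_int f y x0 x2 = plus (horizontal_int f y x0 x1) (horizontal_int f y x1 x2)).
  { intros y Hy; symmetry; apply vint_Chasles; eapply horizontal_integrable; eauto. }
  assert (Hv : forall x,
            vertical_int f x y0 y2 = plus (vertical_int f x y0 y1) (vertical_int f x y1 y2)).
  { intros x; symmetry; apply vint_Chasles; eapply vertical_integrable; eauto. }
  rewrite (Hh y0), (Hh y2), (Hv x0), (Hv x2) by assumption.
  vector; ring.
Qed.

(** An affine function has circulation zero: the difference of its values on the two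
    horizontal sides is the constant [- i b l], on the two vertical sides [a l], and
    [a (- i b l) + i b (a l) = 0]. So only the deviation [K] of [f] from its first order
    expansion counts, integrated along the perimeter. *)
Lemma circulation_estimate {X : CompleteNormedModule C_AbsRing} (f : C -> X)
    (H x y a b K : R) (p : C) (l : X) :
  holomorphic_on X (strip H) f -> Rabs y < H -> Rabs (y + b) < H ->
  0 <= a -> 0 <= b ->
  (forall s t, x <= s <= x + a -> y <= t <= y + b ->
     norm (minus (minus (f (s, t)) (f p)) (scal ((s, t) - p)%C l)) <= K) ->
  norm (circulation f x (x + a) y (y + b)) <= 2 * (a + b) * K.
Proof.
  intros Hf Hy Hyb Ha Hb HK.
  (* Deviations from the constant differences that an affine function would have. *)
  set (A := fun t => minus (minus (f (t, y)) (f (t, y + b))) (scal (- (Ci * b))%C l)).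
  set (v := fun s t => scal Ci (f (s, t)) : X).
  set (B := fun t => minus (minus (v (x + a) t) (v x t)) (scal (Ci * a)%C l)).
  assert (HhI : forall t, Rabs t < H -> vintegrable (fun s => f (s, t)) x (x + a))
    by (intros; eapply horizontal_integrable; eauto).
  assert (HvI : forall s, vintegrable (fun t => v s t) y (y + b))
    by (intros; eapply vertical_integrable; eauto).
  assert (Hc : forall c d (v : X), vintegrable (fun _ => v) c d)
    by (intros; apply vintegrable_continuous; intros; apply continuous_const).
  assert (Hm : forall (g h : R -> X) c d, vintegrable g c d -> vintegrable h c d ->
             vintegrable (fun t => minus (g t) (h t)) c d).
  { intros g h c d Hg Hh.
    exact (ex_RInt_minus (V := real_CompleteNormedModule X) g h c d Hg Hh). }
  assert (HA : vintegrable A x (x + a)) by (unfold A; auto).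
  assert (HB : vintegrable B y (y + b)) by (unfold B; auto).
  assert (Hsum : circulation f x (x + a) y (y + b)
                 = plus (vint A x (x + a)) (vint B y (y + b))).
  { unfold circulation, horizontal_int, vertical_int.
    assert (HAe : vint A x (x + a) =
      minus (minus (vint (fun t => f (t, y)) x (x + a))
                   (vint (fun t => f (t, y + b)) x (x + a)))
            (scal (RtoC a) (scal (- (Ci * b))%C l))).
    { unfold A; rewrite 2!vint_minus, vint_const by auto.
      now replace (x + a - x) with a by ring. }
    assert (HBe : vint B y (y + b) =
      minus (minus (vint (fun t => v (x + a) t) y (y + b))
                   (vint (fun t => v x t) y (y + b)))
            (scal (RtoC b) (scal (Ci * a)%C l))).
    { unfold B; rewrite 2!vint_minus, vint_const by auto.
      now replace (y + b - y) with b by ring. }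
    rewrite HAe, HBe; unfold v; vector; ring. }
  rewrite Hsum; apply Rle_trans with (1 := norm_plus_le _ _).
  assert (HAn : norm (vint A x (x + a)) <= (x + a - x) * (2 * K)).
  { apply vint_norm_le; [lra|assumption|]; intros t Ht.
    replace (A t) with
      (minus (minus (minus (f (t, y)) (f p)) (scal ((t, y) - p)%C l))
             (minus (minus (f (t, y + b)) (f p)) (scal ((t, (y + b)%R) - p)%C l))).
    - apply Rle_trans with (1 := norm_minus_le _ _).
      assert (H1 := HK t y Ht ltac:(lra)); assert (H2 := HK t (y + b) Ht ltac:(lra)); lra.
    - unfold A; vector; try ring; apply injective_projections; simpl; ring. }
  assert (HBn : norm (vint B y (y + b)) <= (y + b - y) * (2 * K)).
  { apply vint_norm_le; [lra|assumption|]; intros t Ht.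
    replace (B t) with (scal Ci
      (minus (minus (minus (f (x + a, t)) (f p)) (scal (((x + a)%R, t) - p)%C l))
             (minus (minus (f (x, t)) (f p)) (scal ((x, t) - p)%C l)))).
    - apply Rle_trans with (1 := norm_scal_Ci _).
      apply Rle_trans with (1 := norm_minus_le _ _).
      assert (H1 := HK (x + a) t ltac:(lra) Ht); assert (H2 := HK x t ltac:(lra) Ht); lra.
    - unfold B, v; vector; try ring; apply injective_projections; simpl; ring. }
  lra.
Qed.

(** The property carried by the induction is that the circulation is at most [c / 4 ^ n].
    It is additive over quarters; on a small rectangle around a point it holds because
    both the perimeter and the distance to the point are of order [1 / 2 ^ n], which
    multiplies the first order error by [1 / 4 ^ n]. *)
Lemma goursat_oriented {X : CompleteNormedModule C_AbsRing} (f : C -> X)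
    (H x0 y0 a b : R) :
  holomorphic_on X (strip H) f -> Rabs y0 < H -> Rabs (y0 + b) < H ->
  0 <= a -> 0 <= b -> circulation f x0 (x0 + a) y0 (y0 + b) = zero.
Proof.
  intros Hf Hy Hyb Ha Hb; apply (norm_eq_zero (V := X)).
  assert (Hin : forall t, y0 <= t <= y0 + b -> Rabs t < H).
  { intros t Ht; apply Rabs_def2 in Hy, Hyb; apply Rabs_def1; lra. }
  apply Rle_antisym; [|exact (norm_ge_0 (V := X) _)].
  apply le_epsilon; intros c Hc; rewrite Rplus_0_l.
  enough (HQ : norm (circulation f x0 (x0 + a / 2 ^ 0) y0 (y0 + b / 2 ^ 0)) <= c / 4 ^ 0)
    by (simpl in HQ; now rewrite !Rdiv_1_r in HQ).
  apply (rectangle_induction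
    (fun n x y => norm (circulation f x (x + a / 2 ^ n) y (y + b / 2 ^ n)) <= c / 4 ^ n)
    x0 y0 a b Ha Hb).
  - intros n x y H1 H2 H3 H4 HQ.
    assert (Hb' := div_pow2_ge_0 b (S n) Hb).
    rewrite (half_step a n); rewrite (half_step b n) in H4 |- *.
    set (a' := a / 2 ^ S n) in *; set (b' := b / 2 ^ S n) in *.
    replace (x + 2 * a') with (x + a' + a') by ring.
    replace (y + 2 * b') with (y + b' + b') by ring.
    rewrite (circulation_split f H x (x + a') _ y (y + b') _ Hf)
      by (apply Hin; lra).
    replace (c / 4 ^ n) with (4 * (c / 4 ^ S n))
      by (simpl; field; apply pow_nonzero; lra).
    eapply Rle_trans; [apply norm_plus_le|].
    eapply Rle_trans; [apply Rplus_le_compat; apply norm_plus_le|].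
    assert (Q1 := HQ x y); assert (Q2 := HQ (x + a') y).
    assert (Q3 := HQ x (y + b')); assert (Q4 := HQ (x + a') (y + b')).
    specialize (Q1 ltac:(now left) ltac:(now left)).
    specialize (Q2 ltac:(now right) ltac:(now left)).
    specialize (Q3 ltac:(now left) ltac:(now right)).
    specialize (Q4 ltac:(now right) ltac:(now right)); lra.
  - intros s t Hs Ht.
    destruct (Hf (s, t) (Hin t Ht)) as [l Hl].
    (* The perimeter estimate below costs a factor [2 (a + b) ^ 2]. *)
    set (eps := c / (2 * ((a + b) * (a + b) + 1))).
    assert (Heps : 0 < eps) by (apply Rdiv_lt_0_compat; nra).
    destruct (derive_first_order f (s, t) l Hl eps Heps) as [delta [Hdelta Hfo]].
    exists delta; split; [assumption|].
    intros n x y Hn H1 H2 H3 H4 Hxs Hyt.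
    assert (Han := div_pow2_ge_0 a n Ha); assert (Hbn := div_pow2_ge_0 b n Hb).
    set (d := a / 2 ^ n + b / 2 ^ n) in *.
    apply Rle_trans with (2 * d * (eps * d)).
    + apply (circulation_estimate f H _ _ _ _ _ (s, t) l); auto;
        try (apply Hin; lra).
      intros s' t' Hs' Ht'.
      assert (Hd : Cmod ((s', t') - (s, t)) <= d).
      { apply Rle_trans with (1 := Cmod_le_sum _); simpl.
        apply Rplus_le_compat; apply Rabs_le; lra. }
      apply Rle_trans with (1 := Hfo (s', t') ltac:(lra)).
      apply Rmult_le_compat_l; lra.
    + replace (2 * d * (eps * d)) with (2 * eps * ((a + b) * (a + b)) / 4 ^ n).
      * apply Rmult_le_compat_r; [left; apply Rinv_0_lt_compat, pow_lt; lra|].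
        apply Rle_trans with (2 * eps * ((a + b) * (a + b) + 1)); [nra|].
        right; unfold eps; field; nra.
      * unfold d; replace 4 with (2 * 2) by ring; rewrite Rpow_mult_distr; field.
        apply pow_nonzero; lra.
Qed.

(** Exchanging the ends of either side changes the sign of the circulation, so that the
    corners can be given in any order. *)
Lemma goursat_rectangle {X : CompleteNormedModule C_AbsRing} (f : C -> X) (H x0 x1 y0 y1 : R) :
  holomorphic_on X (strip H) f -> Rabs y0 < H -> Rabs y1 < H ->
  circulation f x0 x1 y0 y1 = zero.
Proof.
  intros Hf H0 H1.
  assert (Hswap_h : forall y c d, Rabs y < H -> 
            horizontal_int f y d c = opp (horizontal_int f y c d)).
  { intros y c d Hy; apply vint_swap; eapply horizontal_integrable; eauto. }
  assert (Hswap_v : forall x c d, Rabs c < H -> Rabs d < H ->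
            vertical_int f x d c = opp (vertical_int f x c d)).
  { intros x c d Hc Hd; apply vint_swap; eapply vertical_integrable; eauto. }
  assert (Hpos : forall c d, Rabs c < H -> Rabs d < H -> c <= d ->
            circulation f x0 x1 c d = zero).
  { intros c d Hc Hd Hcd.
    assert (Hle : forall u v, u <= v -> circulation f u v c d = zero).
    { intros u v Huv.
      replace v with (u + (v - u)) by ring; replace d with (c + (d - c)) by ring.
      apply (goursat_oriented f H); auto; try lra.
      now replace (c + (d - c)) with d by ring. }
    destruct (Rle_dec x0 x1) as [Hx|Hx]; [now apply Hle|].
    assert (Hr : circulation f x0 x1 c d = opp (circulation f x1 x0 c d)).
    { unfold circulation; rewrite (Hswap_h c x1 x0), (Hswap_h d x1 x0) by assumption.
      vector; ring. }
    rewrite Hr, Hle by lra; vector. }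
  destruct (Rle_dec y0 y1) as [Hy|Hy]; [now apply Hpos|].
  assert (Hr : circulation f x0 x1 y0 y1 = opp (circulation f x0 x1 y1 y0)).
  { unfold circulation; rewrite (Hswap_v x0 y1 y0), (Hswap_v x1 y1 y0) by assumption.
    vector; ring. }
  rewrite Hr, Hpos by (assumption || lra); vector.
Qed.

(** * A primitive and its five-point Laplacian *)

(** The path of integration runs from the origin along the real axis and then
    vertically, which makes vertical increments obvious and leaves the horizontal ones to
    Goursat. *)
Definition complex_primitive {X : CompleteNormedModule C_AbsRing} (f : C -> X) (z : C) : X :=
  plus (horizontal_int f 0 0 (Re z)) (vertical_int f (Re z) 0 (Im z)).

(** By Goursat the path along the axis can be replaced by the one at height [y]. *)
Lemma primitive_horizontal_step {X : CompleteNormedModule C_AbsRing} (f : C -> X) (H x x' y : R) :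
  holomorphic_on X (strip H) f -> Rabs y < H ->
  minus (complex_primitive f (x', y)) (complex_primitive f (x, y)) = horizontal_int f y x x'.
Proof.
  intros Hf Hy.
  assert (H0 : Rabs 0 < H) by (rewrite Rabs_R0; assert (Hy0 := Rabs_pos y); lra).
  assert (Hh : horizontal_int f 0 0 x' = plus (horizontal_int f 0 0 x) (horizontal_int f 0 x x')).
  { symmetry; apply vint_Chasles; eapply horizontal_integrable; eauto. }
  transitivity (plus (circulation f x x' 0 y) (horizontal_int f y x x')).
  - unfold complex_primitive, circulation; simpl; rewrite Hh; vector; ring.
  - rewrite (goursat_rectangle f H) by assumption; vector; ring.
Qed.

Lemma primitive_vertical_step {X : CompleteNormedModule C_AbsRing} (f : C -> X) (H x y y' : R) :
  holomorphic_on X (strip H) f -> Rabs y < H -> Rabs y' < H ->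
  minus (complex_primitive f (x, y')) (complex_primitive f (x, y)) = vertical_int f x y y'.
Proof.
  intros Hf Hy Hy'.
  assert (H0 : Rabs 0 < H) by (rewrite Rabs_R0; assert (Hy0 := Rabs_pos y); lra).
  assert (Hv : vertical_int f x 0 y' = plus (vertical_int f x 0 y) (vertical_int f x y y')).
  { symmetry; apply vint_Chasles; eapply vertical_integrable; eauto. }
  unfold complex_primitive; simpl; rewrite Hv; vector; ring.
Qed.

(** [h ^ 2] times the five-point discrete Laplacian. *)
Definition laplace5 {X : CompleteNormedModule C_AbsRing} (g : C -> X) (x y h : R) : X :=
  minus (plus (plus (g (x + h, y)) (g (x - h, y))) (plus (g (x, y + h)) (g (x, y - h))))
        (scal (RtoC 4) (g (x, y))).

(** Any function with a second order Taylor expansion over [C] has this property, since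
    the fourth roots of unity and their squares both have sum zero. Being a pointwise
    condition, it can be tested at a maximum. *)
Definition asymptotically_harmonic {X : CompleteNormedModule C_AbsRing}
    (g : C -> X) (x y : R) : Prop :=
  forall eps, 0 < eps -> exists delta, 0 < delta /\
    forall h, 0 < h < delta -> norm (laplace5 g x y h) <= eps * (h * h).

Lemma RtoC_4 : RtoC 4 = (1 + 1 + (1 + 1))%C.
Proof. apply injective_projections; simpl; ring. Qed.

(** The four increments of the primitive are integrals of [f] along segments issuing from
    the point. In their sum the values [f (x, y)] cancel and the first order terms give
    [2 t l + i (2 i t l) = 0], so the integrand is [o(t)]. Only one derivative
    of [f] is used: this is the gain of working with a primitive. *)
Lemma primitive_harmonic {X : CompleteNormedModule C_AbsRing} (f : C -> X) (H x y : R) :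
  holomorphic_on X (strip H) f -> Rabs y < H ->
  asymptotically_harmonic (complex_primitive f) x y.
Proof.
  intros Hf Hy eps Heps.
  destruct (Hf (x, y) Hy) as [l Hl].
  destruct (derive_first_order f (x, y) l Hl (eps / 4) ltac:(lra)) as [d [Hd Hfo]].
  exists (Rmin d (H - Rabs y)); split; [apply Rmin_pos; lra|].
  intros h [Hh Hhd].
  assert (Hd1 := Rlt_le_trans _ _ _ Hhd (Rmin_l _ _)).
  assert (Hd2 := Rlt_le_trans _ _ _ Hhd (Rmin_r _ _)).
  assert (Hstrip : forall t, Rabs t <= h -> Rabs (y + t) < H).
  { intros t Ht; apply Rle_lt_trans with (1 := Rabs_triang _ _); lra. }
  assert (Hy1 : Rabs (y + h) < H) by (apply Hstrip; rewrite Rabs_pos_eq; lra).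
  assert (Hy2 : Rabs (y - h) < H).
  { unfold Rminus; apply Hstrip; rewrite Rabs_Ropp, Rabs_pos_eq; lra. }
  set (hz := fun t => f (t, y)); set (vt := fun t => scal Ci (f (x, t)) : X).
  destruct (vint_shift hz x h) as [I1 E1];
    [unfold hz; eapply horizontal_integrable; eauto|].
  destruct (vint_reflect hz x h) as [I2 E2];
    [unfold hz; eapply horizontal_integrable; eauto|].
  destruct (vint_shift vt y h) as [I3 E3];
    [unfold vt; eapply vertical_integrable; eauto|].
  destruct (vint_reflect vt y h) as [I4 E4];
    [unfold vt; eapply vertical_integrable; eauto|].
  set (hd := fun t => minus (hz (x + t)) (hz (x - t))).
  set (vd := fun t => minus (vt (y + t)) (vt (y - t))).
  assert (Ihd : vintegrable hd 0 h)
    by exact (ex_RInt_minus (V := real_CompleteNormedModule X) _ _ _ _ I1 I2).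
  assert (Ivd : vintegrable vd 0 h)
    by exact (ex_RInt_minus (V := real_CompleteNormedModule X) _ _ _ _ I3 I4).
  assert (Hlap : laplace5 (complex_primitive f) x y h = vint (fun t => plus (hd t) (vd t)) 0 h).
  { transitivity (plus (vint hd 0 h) (vint vd 0 h));
      [|symmetry; exact (vint_plus hd vd 0 h Ihd Ivd)].
    assert (Eh : vint hd 0 h = minus (vint hz x (x + h)) (vint hz (x - h) x))
      by (rewrite <- E1, <- E2; exact (vint_minus _ _ _ _ I1 I2)).
    assert (Ev : vint vd 0 h = minus (vint vt y (y + h)) (vint vt (y - h) y))
      by (rewrite <- E3, <- E4; exact (vint_minus _ _ _ _ I3 I4)).
    rewrite Eh, Ev.
    change (vint hz x (x + h)) with (horizontal_int f y x (x + h)).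
    change (vint hz (x - h) x) with (horizontal_int f y (x - h) x).
    change (vint vt y (y + h)) with (vertical_int f x y (y + h)).
    change (vint vt (y - h) y) with (vertical_int f x (y - h) y).
    rewrite <- !(primitive_horizontal_step f H), <- !(primitive_vertical_step f H) by assumption.
    unfold laplace5; rewrite RtoC_4; vector; ring. }
  rewrite Hlap.
  replace (eps * (h * h)) with ((h - 0) * (eps * h)) by ring.
  apply vint_norm_le; [lra| |].
  { exact (ex_RInt_plus (V := real_CompleteNormedModule X) _ _ _ _ Ihd Ivd). }
  intros t Ht.
  set (E := fun w => minus (minus (f w) (f (x, y))) (scal (w - (x, y))%C l)).
  assert (HE : forall w, Cmod (w - (x, y)) = t -> norm (E w) <= eps / 4 * h).
  { intros w Hw; apply Rle_trans with (1 := Hfo w ltac:(lra)); rewrite Hw.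
    apply Rmult_le_compat_l; lra. }
  replace (plus (hd t) (vd t)) with
    (plus (minus (E (x + t, y)) (E (x - t, y)))
          (scal Ci (minus (E (x, y + t)) (E (x, y - t))))).
  - assert (N1 : norm (E (x + t, y)) <= eps / 4 * h).
    { apply HE; replace (((x + t)%R, y) - (x, y))%C with (RtoC t)
        by (apply injective_projections; simpl; ring).
      rewrite Cmod_R, Rabs_pos_eq; lra. }
    assert (N2 : norm (E (x - t, y)) <= eps / 4 * h).
    { apply HE; replace (((x - t)%R, y) - (x, y))%C with (RtoC (- t))
        by (apply injective_projections; simpl; ring).
      rewrite Cmod_R, Rabs_Ropp, Rabs_pos_eq; lra. }
    assert (N3 : norm (E (x, y + t)) <= eps / 4 * h).
    { apply HE; replace ((x, (y + t)%R) - (x, y))%C with (Ci * RtoC t)%C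
        by (apply injective_projections; simpl; ring).
      rewrite Cmod_mult, Cmod_Ci, Cmod_R, Rabs_pos_eq; lra. }
    assert (N4 : norm (E (x, y - t)) <= eps / 4 * h).
    { apply HE; replace ((x, (y - t)%R) - (x, y))%C with (Ci * RtoC (- t))%C
        by (apply injective_projections; simpl; ring).
      rewrite Cmod_mult, Cmod_Ci, Cmod_R, Rabs_Ropp, Rabs_pos_eq; lra. }
    eapply Rle_trans; [apply norm_plus_le|].
    eapply Rle_trans; [apply Rplus_le_compat; [apply norm_minus_le|apply norm_scal_Ci]|].
    eapply Rle_trans; [apply Rplus_le_compat_l, norm_minus_le|]; lra.
  - unfold hd, vd, hz, vt, E; vector; try ring; apply injective_projections; simpl; ring.
Qed.

Lemma between_dist (a b t : R) : Rmin a b <= t <= Rmax a b -> Rabs (t - a) <= Rabs (b - a).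
Proof.
  unfold Rmin, Rmax; destruct (Rle_dec a b); intros Ht.
  - rewrite !Rabs_pos_eq; lra.
  - rewrite !Rabs_left1; lra.
Qed.

(** The increment of the primitive is an integral over a path of length at most
    [|x' - x| + |y' - y|], on which [f] is bounded. *)
Lemma primitive_continuous {X : CompleteNormedModule C_AbsRing} (f : C -> X) (H x y : R) :
  holomorphic_on X (strip H) f -> Rabs y < H -> forall eps, 0 < eps ->
  exists delta, 0 < delta /\ forall x' y', Rabs (x' - x) < delta -> Rabs (y' - y) < delta ->
    norm (minus (complex_primitive f (x', y')) (complex_primitive f (x, y))) < eps.
Proof.
  intros Hf Hy eps Heps.
  destruct (ex_derive_near f (x, y) (Hf (x, y) Hy) 1 Rlt_0_1) as [d [Hd Hloc]].
  set (N := norm (f (x, y)) + 1).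
  assert (HN : 0 < N) by (assert (Hn := norm_ge_0 (V := X) (f (x, y))); unfold N; lra).
  set (delta := Rmin (Rmin (d / 2) (H - Rabs y)) (eps / (2 * N))).
  assert (HD1 : delta <= d / 2)
    by (apply Rle_trans with (1 := Rmin_l _ _); apply Rmin_l).
  assert (HD2 : delta <= H - Rabs y)
    by (apply Rle_trans with (1 := Rmin_l _ _); apply Rmin_r).
  assert (HD3 : delta <= eps / (2 * N)) by apply Rmin_r.
  exists delta; split.
  { repeat apply Rmin_pos; try lra; apply Rdiv_lt_0_compat; lra. }
  intros x' y' Hx' Hy'.
  assert (Hy1 : Rabs y' < H).
  { replace y' with (y + (y' - y)) by ring.
    apply Rle_lt_trans with (1 := Rabs_triang _ _); lra. }
  assert (Hbound : forall s t, Rabs (s - x) <= Rabs (x' - x) ->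
            Rabs (t - y) <= Rabs (y' - y) -> norm (f (s, t)) <= N).
  { intros s t Hs Ht.
    replace (f (s, t)) with (plus (minus (f (s, t)) (f (x, y))) (f (x, y)))
      by (vector; ring).
    apply Rle_trans with (1 := norm_plus_le _ _).
    assert (Hw : Cmod ((s, t) - (x, y)) < d).
    { apply Rle_lt_trans with (1 := Cmod_le_sum _); simpl.
      change (Rabs (s - x) + Rabs (t - y) < d); lra. }
    specialize (Hloc _ Hw); unfold N; lra. }
  replace (minus (complex_primitive f (x', y')) (complex_primitive f (x, y)))
    with (plus (horizontal_int f y x x') (vertical_int f x' y y')).
  2: { rewrite <- (primitive_horizontal_step f H), <- (primitive_vertical_step f H) by assumption.
       vector; ring. }
  apply Rle_lt_trans with (1 := norm_plus_le _ _).
  assert (N1 : norm (horizontal_int f y x x') <= Rabs (x' - x) * N).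
  { apply vint_norm_le_abs; [eapply horizontal_integrable; eauto|]; intros t Ht.
    apply Hbound; [now apply between_dist|].
    replace (y - y) with 0 by ring; rewrite Rabs_R0; apply Rabs_pos. }
  assert (N2 : norm (vertical_int f x' y y') <= Rabs (y' - y) * N).
  { apply vint_norm_le_abs; [eapply vertical_integrable; eauto|]; intros t Ht.
    apply Rle_trans with (1 := norm_scal_Ci _).
    apply Hbound; [apply Rle_refl|now apply between_dist]. }
  assert (Hq : 2 * delta * N <= eps).
  { apply Rle_trans with (2 * (eps / (2 * N)) * N).
    - apply Rmult_le_compat_r; lra.
    - right; field; lra. }
  nra.
Qed.

(** * The maximum principle *)

(** If no maximum existed, every point would be strictly beaten by another one. Being
    beaten everywhere by a single point passes to the whole from four quarters (take the
    best of the four points) and holds near each point by semicontinuity; on the whole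
    rectangle it is absurd. *)
Lemma rectangle_argmax (u : R -> R -> R) (x0 y0 a b : R) :
  0 <= a -> 0 <= b ->
  (forall s t, x0 <= s <= x0 + a -> y0 <= t <= y0 + b -> forall eps, 0 < eps ->
     exists delta, 0 < delta /\ forall s' t',
       x0 <= s' <= x0 + a -> y0 <= t' <= y0 + b ->
       Rabs (s' - s) < delta -> Rabs (t' - t) < delta -> u s' t' < u s t + eps) ->
  exists s t, (x0 <= s <= x0 + a /\ y0 <= t <= y0 + b) /\
    forall s' t', x0 <= s' <= x0 + a -> y0 <= t' <= y0 + b -> u s' t' <= u s t.
Proof.
  intros Ha Hb Husc; apply NNPP; intros Hno.
  assert (Hbig : forall s t, x0 <= s <= x0 + a -> y0 <= t <= y0 + b ->
            exists p q, (x0 <= p <= x0 + a /\ y0 <= q <= y0 + b) /\ u s t < u p q).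
  { intros s t Hs Ht; apply NNPP; intros Hn; apply Hno.
    exists s, t; split; [tauto|]; intros s' t' Hs' Ht'.
    apply Rnot_lt_le; intros Hlt; apply Hn; now exists s', t'. }
  set (Q := fun (n : nat) x y => exists p q, (x0 <= p <= x0 + a /\ y0 <= q <= y0 + b) /\
     forall s t, x <= s <= x + a / 2 ^ n -> y <= t <= y + b / 2 ^ n -> u s t < u p q).
  enough (HQ : Q O x0 y0).
  { destruct HQ as (p & q & [Hp Hq] & HQ); simpl in HQ; rewrite !Rdiv_1_r in HQ.
    exact (Rlt_irrefl _ (HQ p q Hp Hq)). }
  apply (rectangle_induction Q x0 y0 a b Ha Hb).
  - intros n x y _ _ _ _ HQ.
    assert (Hmax : forall p q p' q',
      (x0 <= p <= x0 + a /\ y0 <= q <= y0 + b) ->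
      (x0 <= p' <= x0 + a /\ y0 <= q' <= y0 + b) ->
      exists r s, (x0 <= r <= x0 + a /\ y0 <= s <= y0 + b) /\
        u p q <= u r s /\ u p' q' <= u r s).
    { intros p q p' q' Hp Hp'; destruct (Rle_dec (u p q) (u p' q')).
      - exists p', q'; split; [tauto|lra].
      - exists p, q; split; [tauto|lra]. }
    assert (Q1 := HQ x y); assert (Q2 := HQ (x + a / 2 ^ S n) y).
    assert (Q3 := HQ x (y + b / 2 ^ S n)).
    assert (Q4 := HQ (x + a / 2 ^ S n) (y + b / 2 ^ S n)).
    destruct (Q1 ltac:(now left) ltac:(now left)) as (p1 & q1 & K1 & L1).
    destruct (Q2 ltac:(now right) ltac:(now left)) as (p2 & q2 & K2 & L2).
    destruct (Q3 ltac:(now left) ltac:(now right)) as (p3 & q3 & K3 & L3).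
    destruct (Q4 ltac:(now right) ltac:(now right)) as (p4 & q4 & K4 & L4).
    destruct (Hmax _ _ _ _ K1 K2) as (r1 & s1 & K5 & M1 & M2).
    destruct (Hmax _ _ _ _ K3 K4) as (r2 & s2 & K6 & M3 & M4).
    destruct (Hmax _ _ _ _ K5 K6) as (r & s & K7 & M5 & M6).
    exists r, s; split; [assumption|]; intros s' t'.
    rewrite (half_step a n), (half_step b n); intros Hs' Ht'.
    destruct (Rle_dec s' (x + a / 2 ^ S n)), (Rle_dec t' (y + b / 2 ^ S n)).
    + specialize (L1 s' t' ltac:(lra) ltac:(lra)); lra.
    + specialize (L3 s' t' ltac:(lra) ltac:(lra)); lra.
    + specialize (L2 s' t' ltac:(lra) ltac:(lra)); lra.
    + specialize (L4 s' t' ltac:(lra) ltac:(lra)); lra.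
  - intros s t Hs Ht; destruct (Hbig s t Hs Ht) as (p & q & Hpq & Hlt).
    destruct (Husc s t Hs Ht (u p q - u s t) ltac:(lra)) as [delta [Hdelta Hu]].
    exists delta; split; [assumption|]; intros n x y Hn H1 H2 H3 H4 Hxs Hyt.
    exists p, q; split; [assumption|]; intros s' t' Hs' Ht'.
    assert (Han := div_pow2_ge_0 a n Ha); assert (Hbn := div_pow2_ge_0 b n Hb).
    replace (u p q) with (u s t + (u p q - u s t)) by ring.
    apply Hu; try lra; apply Rabs_def1; lra.
Qed.

(** If [u] exceeded [M] inside, then so would the maximum of [u + eta s ^ 2] for a small
    [eta], at an interior point. There the quadratic term contributes [2 eta h ^ 2] to the
    sum over the four neighbours, more than the error allowed for [u]. *)
Lemma discrete_max_principle (u : R -> R -> R) (x0 y0 a b M : R) :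
  0 <= a -> 0 <= b ->
  (forall s t, x0 <= s <= x0 + a -> y0 <= t <= y0 + b -> forall eps, 0 < eps ->
     exists delta, 0 < delta /\ forall s' t',
       x0 <= s' <= x0 + a -> y0 <= t' <= y0 + b ->
       Rabs (s' - s) < delta -> Rabs (t' - t) < delta -> u s' t' < u s t + eps) ->
  (forall x y, x0 < x < x0 + a -> y0 < y < y0 + b -> forall eps, 0 < eps ->
     exists delta, 0 < delta /\ forall h, 0 < h < delta ->
       4 * u x y <= u (x + h) y + u (x - h) y + u x (y + h) + u x (y - h) + eps * (h * h)) ->
  (forall s t, x0 <= s <= x0 + a -> y0 <= t <= y0 + b ->
     s = x0 \/ s = x0 + a \/ t = y0 \/ t = y0 + b -> u s t <= M) ->
  forall s t, x0 <= s <= x0 + a -> y0 <= t <= y0 + b -> u s t <= M.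
Proof.
  intros Ha Hb Husc Hsub Hbdry s t Hs Ht; apply Rnot_lt_le; intros Hlt.
  set (B := x0 * x0 + (x0 + a) * (x0 + a)).
  assert (HB : forall r, x0 <= r <= x0 + a -> 0 <= r * r <= B)
    by (intros r Hr; split; [apply Rle_0_sqr|]; unfold B;
        assert (S1 := Rle_0_sqr x0); assert (S2 := Rle_0_sqr (x0 + a)); unfold Rsqr in *;
        destruct (Rle_dec 0 r); nra).
  assert (HB0 : 0 <= B) by (unfold B; nra).
  (* Small enough that the quadratic term cannot bridge the gap [u s t - M]. *)
  set (eta := (u s t - M) / (B + 1)).
  assert (Heta : 0 < eta) by (apply Rdiv_lt_0_compat; lra).
  assert (HetaB : eta * B < u s t - M).
  { replace (u s t - M) with (eta * (B + 1)) by (unfold eta; field; lra); lra. }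
  destruct (rectangle_argmax (fun s t => u s t + eta * (s * s)) x0 y0 a b Ha Hb)
    as (x & y & [Hx Hy] & Hmax).
  - intros s1 t1 Hs1 Ht1 eps Heps.
    destruct (Husc s1 t1 Hs1 Ht1 (eps / 2) ltac:(lra)) as [d [Hd Hu]].
    set (L := 2 * (Rabs x0 + a) + 1).
    assert (HL : 0 < L) by (assert (Hp := Rabs_pos x0); unfold L; lra).
    exists (Rmin d (eps / (2 * eta * L))); split.
    { apply Rmin_pos; [assumption|]; apply Rdiv_lt_0_compat; [lra|].
      apply Rmult_lt_0_compat; lra. }
    intros s' t' Hs' Ht' Hds Hdt.
    assert (Hds1 := Rlt_le_trans _ _ _ Hds (Rmin_l _ _)).
    assert (Hdt1 := Rlt_le_trans _ _ _ Hdt (Rmin_l _ _)).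
    assert (Hds2 := Rlt_le_trans _ _ _ Hds (Rmin_r _ _)).
    specialize (Hu s' t' Hs' Ht' Hds1 Hdt1).
    assert (Hsq : s' * s' - s1 * s1 <= Rabs (s' - s1) * L).
    { replace (s' * s' - s1 * s1) with ((s' - s1) * (s' + s1)) by ring.
      apply Rle_trans with (1 := Rle_abs _); rewrite Rabs_mult.
      apply Rmult_le_compat_l; [apply Rabs_pos|]; unfold L.
      assert (Hp1 := Rle_abs x0); assert (Hp2 := Rle_abs (- x0)).
      rewrite Rabs_Ropp in Hp2; apply Rabs_le; lra. }
    assert (Hsm : eta * (Rabs (s' - s1) * L) < eps / 2).
    { apply Rmult_lt_compat_r with (r := eta * L) in Hds2;
        [|apply Rmult_lt_0_compat; lra].
      replace (eps / (2 * eta * L) * (eta * L)) with (eps / 2) in Hds2 by (field; lra).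
      lra. }
    apply Rmult_le_compat_l with (r := eta) in Hsq; lra.
  - assert (Hv := Hmax s t Hs Ht); assert (Hs2 := HB s Hs); assert (Hx2 := HB x Hx).
    assert (Hxy : M < u x y) by nra.
    destruct (Rle_lt_dec x x0) as [E|Hx1];
      [apply (Rlt_not_le _ _ Hxy), Hbdry; auto; left; lra|].
    destruct (Rle_lt_dec (x0 + a) x) as [E|Hx3];
      [apply (Rlt_not_le _ _ Hxy), Hbdry; auto; right; left; lra|].
    destruct (Rle_lt_dec y y0) as [E|Hy1];
      [apply (Rlt_not_le _ _ Hxy), Hbdry; auto; do 2 right; left; lra|].
    destruct (Rle_lt_dec (y0 + b) y) as [E|Hy3];
      [apply (Rlt_not_le _ _ Hxy), Hbdry; auto; do 3 right; lra|].
    destruct (Hsub x y ltac:(lra) ltac:(lra) eta Heta) as [d [Hd Hlap]].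
    set (m := Rmin (Rmin d (Rmin (x - x0) (x0 + a - x))) (Rmin (y - y0) (y0 + b - y))).
    assert (Hm : 0 < m) by (repeat apply Rmin_pos; lra).
    assert (Hm1 : m <= d /\ m <= x - x0 /\ m <= x0 + a - x /\
                  m <= y - y0 /\ m <= y0 + b - y).
    { assert (R1 := Rmin_l (Rmin d (Rmin (x - x0) (x0 + a - x)))
                             (Rmin (y - y0) (y0 + b - y))).
      assert (R2 := Rmin_r (Rmin d (Rmin (x - x0) (x0 + a - x)))
                             (Rmin (y - y0) (y0 + b - y))).
      fold m in R1, R2.
      assert (R3 := Rmin_l d (Rmin (x - x0) (x0 + a - x))).
      assert (R4 := Rmin_r d (Rmin (x - x0) (x0 + a - x))).
      assert (R5 := Rmin_l (x - x0) (x0 + a - x)); assert (R6 := Rmin_r (x - x0) (x0 + a - x)).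
      assert (R7 := Rmin_l (y - y0) (y0 + b - y)); assert (R8 := Rmin_r (y - y0) (y0 + b - y)).
      lra. }
    set (h := m / 2).
    assert (Hh : 0 < h < m) by (unfold h; lra).
    specialize (Hlap h ltac:(lra)).
    assert (V1 := Hmax (x + h) y ltac:(lra) ltac:(lra)).
    assert (V2 := Hmax (x - h) y ltac:(lra) ltac:(lra)).
    assert (V3 := Hmax x (y + h) ltac:(lra) ltac:(lra)).
    assert (V4 := Hmax x (y - h) ltac:(lra) ltac:(lra)).
    simpl in V1, V2, V3, V4.
    assert (Hpos := Rmult_lt_0_compat _ _ Heta (Rmult_lt_0_compat h h ltac:(lra) ltac:(lra))).
    assert (Hsq : eta * ((x + h) * (x + h)) + eta * ((x - h) * (x - h))
                  = 2 * (eta * (x * x)) + 2 * (eta * (h * h))) by ring.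
    lra.
Qed.

(** A single bound [k] is needed on the whole boundary of the rectangle; it is the minimum
    of the bounds on the four quarters. *)
Lemma uniform_horizontal_shift {X : CompleteNormedModule C_AbsRing} (f : C -> X)
    (H x0 y0 a b : R) :
  holomorphic_on X (strip H) f -> Rabs y0 < H -> Rabs (y0 + b) < H ->
  0 <= a -> 0 <= b -> forall eps, 0 < eps ->
  exists k, 0 < k /\ forall s t r, x0 <= s <= x0 + a -> y0 <= t <= y0 + b ->
    0 <= r <= k -> norm (minus (f (s + r, t)) (f (s, t))) <= eps.
Proof.
  intros Hf Hy Hyb Ha Hb eps Heps.
  set (Q := fun (n : nat) x y => exists k, 0 < k /\ forall s t r,
     x <= s <= x + a / 2 ^ n -> y <= t <= y + b / 2 ^ n -> 0 <= r <= k ->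
     norm (minus (f (s + r, t)) (f (s, t))) <= eps).
  enough (HQ : Q O x0 y0).
  { destruct HQ as (k & Hk & HQ); simpl in HQ; rewrite !Rdiv_1_r in HQ; eauto. }
  apply (rectangle_induction Q x0 y0 a b Ha Hb).
  - intros n x y _ _ _ _ HQ.
    assert (Q1 := HQ x y); assert (Q2 := HQ (x + a / 2 ^ S n) y).
    assert (Q3 := HQ x (y + b / 2 ^ S n)).
    assert (Q4 := HQ (x + a / 2 ^ S n) (y + b / 2 ^ S n)).
    destruct (Q1 ltac:(now left) ltac:(now left)) as (k1 & K1 & L1).
    destruct (Q2 ltac:(now right) ltac:(now left)) as (k2 & K2 & L2).
    destruct (Q3 ltac:(now left) ltac:(now right)) as (k3 & K3 & L3).
    destruct (Q4 ltac:(now right) ltac:(now right)) as (k4 & K4 & L4).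
    exists (Rmin (Rmin k1 k2) (Rmin k3 k4)); split; [repeat apply Rmin_pos; assumption|].
    intros s t r; rewrite (half_step a n), (half_step b n); intros Hs Ht Hr.
    assert (R1 := Rmin_l (Rmin k1 k2) (Rmin k3 k4)).
    assert (R2 := Rmin_r (Rmin k1 k2) (Rmin k3 k4)).
    assert (R3 := Rmin_l k1 k2); assert (R4 := Rmin_r k1 k2).
    assert (R5 := Rmin_l k3 k4); assert (R6 := Rmin_r k3 k4).
    destruct (Rle_dec s (x + a / 2 ^ S n)), (Rle_dec t (y + b / 2 ^ S n)).
    + apply L1; lra.
    + apply L3; lra.
    + apply L2; lra.
    + apply L4; lra.
  - intros s t Hs Ht.
    assert (Hst : strip H (s, t)).
    { unfold strip; simpl; apply Rabs_def2 in Hy, Hyb; apply Rabs_def1; lra. }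
    destruct (ex_derive_near f (s, t) (Hf _ Hst) (eps / 2) ltac:(lra)) as [d [Hd Hloc]].
    exists (d / 2); split; [lra|]; intros n x y Hn H1 H2 H3 H4 Hxs Hyt.
    assert (Han := div_pow2_ge_0 a n Ha); assert (Hbn := div_pow2_ge_0 b n Hb).
    exists (d / 2); split; [lra|]; intros s' t' r Hs' Ht' Hr.
    assert (Hclose : forall q, 0 <= q <= d / 2 ->
              norm (minus (f (s' + q, t')) (f (s, t))) < eps / 2).
    { intros q Hq; apply Hloc; apply Rle_lt_trans with (1 := Cmod_le_sum _); simpl.
      apply Rle_lt_trans with (d / 2 + (a / 2 ^ n + b / 2 ^ n)); [|lra].
      assert (A1 : Rabs (s' + q + - s) <= q + a / 2 ^ n) by (apply Rabs_le; lra).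
      assert (A2 : Rabs (t' + - t) <= b / 2 ^ n) by (apply Rabs_le; lra).
      lra. }
    replace (minus (f (s' + r, t')) (f (s', t')))
      with (minus (minus (f (s' + r, t')) (f (s, t)))
                  (minus (f (s' + 0, t')) (f (s, t)))).
    + apply Rle_trans with (1 := norm_minus_le _ _).
      assert (N1 := Hclose r Hr); assert (N2 := Hclose 0 ltac:(lra)); lra.
    + rewrite Rplus_0_r; vector; ring.
Qed.

(** For [k > 0] let [g z = P (z + k) - P z] with [P] the primitive of [f]. It inherits
    asymptotic harmonicity from [P], hence its norm is subject to the discrete maximum
    principle: a vector is the mean of its four neighbours up to [o(h ^ 2)]. As [g / k] is
    the mean of [f] over a short horizontal segment, letting [k] tend to zero gives the
    result for [f]. *)
Lemma maximum_principle {X : CompleteNormedModule C_AbsRing} (f : C -> X)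
    (H x0 y0 a b M : R) :
  holomorphic_on X (strip H) f -> Rabs y0 < H -> Rabs (y0 + b) < H ->
  0 <= a -> 0 <= b ->
  (forall s t, x0 <= s <= x0 + a -> y0 <= t <= y0 + b ->
     s = x0 \/ s = x0 + a \/ t = y0 \/ t = y0 + b -> norm (f (s, t)) <= M) ->
  forall s t, x0 <= s <= x0 + a -> y0 <= t <= y0 + b -> norm (f (s, t)) <= M.
Proof.
  intros Hf Hy Hyb Ha Hb Hbdry s t Hs Ht.
  assert (Hin : forall r, y0 <= r <= y0 + b -> Rabs r < H).
  { intros r Hr; apply Rabs_def2 in Hy, Hyb; apply Rabs_def1; lra. }
  apply le_epsilon; intros eps Heps.
  destruct (uniform_horizontal_shift f H x0 y0 a b Hf Hy Hyb Ha Hb (eps / 2) ltac:(lra))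
    as (k & Hk & Hshift).
  set (g := fun z => minus (complex_primitive f ((Re z + k)%R, Im z)) (complex_primitive f z)).
  assert (Hg : forall x y, Rabs y < H -> g (x, y) = horizontal_int f y x (x + k))
    by (intros x y Hxy; exact (primitive_horizontal_step f H x (x + k) y Hf Hxy)).
  assert (Hgk : forall x y (v : X) N, y0 <= y <= y0 + b ->
            (forall r, 0 <= r <= k -> norm (minus (f (x + r, y)) v) <= N) ->
            norm (minus (g (x, y)) (scal (RtoC k) v)) <= k * N).
  { intros x y v N Hyr HN; rewrite Hg by auto.
    assert (I : vintegrable (fun t => f (t, y)) x (x + k))
      by (eapply horizontal_integrable; eauto).
    assert (Ic : vintegrable (fun _ => v) x (x + k))
      by (apply vintegrable_continuous; intros; apply continuous_const).
    replace (minus (horizontal_int f y x (x + k)) (scal (RtoC k) v))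
      with (vint (fun r => minus (f (r, y)) v) x (x + k)).
    - replace (k * N) with ((x + k - x) * N) by ring.
      apply vint_norm_le; [lra| |].
      + exact (ex_RInt_minus (V := real_CompleteNormedModule X) _ _ _ _ I Ic).
      + intros r Hr; replace r with (x + (r - x)) by ring; apply HN; lra.
    - transitivity (minus (horizontal_int f y x (x + k)) (vint (fun _ => v) x (x + k))).
      + exact (vint_minus _ _ _ _ I Ic).
      + rewrite vint_const; now replace (x + k - x) with k by ring. }
  assert (Hmain : norm (g (s, t)) <= k * (M + eps / 2)).
  { apply (discrete_max_principle (fun x y => norm (g (x, y))) x0 y0 a b); auto.
    - intros s1 t1 Hs1 Ht1 e He.
      destruct (primitive_continuous f H (s1 + k) t1 Hf (Hin _ Ht1) (e / 2) ltac:(lra))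
        as (d1 & Hd1 & P1).
      destruct (primitive_continuous f H s1 t1 Hf (Hin _ Ht1) (e / 2) ltac:(lra))
        as (d2 & Hd2 & P2).
      exists (Rmin d1 d2); split; [now apply Rmin_pos|].
      intros s' t' _ _ Hds Hdt.
      assert (D1 := Rlt_le_trans _ _ _ Hds (Rmin_l _ _)).
      assert (D2 := Rlt_le_trans _ _ _ Hds (Rmin_r _ _)).
      assert (D3 := Rlt_le_trans _ _ _ Hdt (Rmin_l _ _)).
      assert (D4 := Rlt_le_trans _ _ _ Hdt (Rmin_r _ _)).
      apply Rle_lt_trans with (1 := norm_le_minus _ (g (s1, t1))).
      apply Rplus_lt_compat_l.
      replace (minus (g (s', t')) (g (s1, t1))) with
        (minus (minus (complex_primitive f (s' + k, t')) (complex_primitive f (s1 + k, t1)))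
               (minus (complex_primitive f (s', t')) (complex_primitive f (s1, t1))))
        by (unfold g; simpl; vector; ring).
      apply Rle_lt_trans with (1 := norm_minus_le _ _).
      assert (N1 : norm (minus (complex_primitive f (s' + k, t'))
                               (complex_primitive f (s1 + k, t1))) < e / 2).
      { apply P1; [|assumption]; now replace (s' + k - (s1 + k)) with (s' - s1) by ring. }
      assert (N2 := P2 s' t' D2 D4); lra.
    - intros x y Hx Hy' e He.
      assert (HyH : Rabs y < H) by (apply Hin; lra).
      destruct (primitive_harmonic f H (x + k) y Hf HyH (e / 2) ltac:(lra))
        as (d1 & Hd1 & P1).
      destruct (primitive_harmonic f H x y Hf HyH (e / 2) ltac:(lra))
        as (d2 & Hd2 & P2).
      exists (Rmin d1 d2); split; [now apply Rmin_pos|].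
      intros h [Hh Hhd].
      assert (D1 := Rlt_le_trans _ _ _ Hhd (Rmin_l _ _)).
      assert (D2 := Rlt_le_trans _ _ _ Hhd (Rmin_r _ _)).
      assert (N1 := P1 h (conj Hh D1)); assert (N2 := P2 h (conj Hh D2)).
      assert (Hlap : laplace5 g x y h =
                minus (laplace5 (complex_primitive f) (x + k) y h)
                      (laplace5 (complex_primitive f) x y h)).
      { unfold laplace5, g; simpl.
        replace (x + h + k) with (x + k + h) by ring.
        replace (x - h + k) with (x + k - h) by ring.
        vector; ring. }
      assert (N3 : norm (laplace5 g x y h) <= e * (h * h)).
      { rewrite Hlap; apply Rle_trans with (1 := norm_minus_le _ _); lra. }
      rewrite <- norm_scal_pos by lra.
      replace (scal (RtoC 4) (g (x, y))) with
        (minus (plus (plus (g (x + h, y)) (g (x - h, y)))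
                     (plus (g (x, y + h)) (g (x, y - h)))) (laplace5 g x y h))
        by (unfold laplace5; vector; ring).
      apply Rle_trans with (1 := norm_minus_le _ _).
      apply Rplus_le_compat; [|assumption].
      eapply Rle_trans; [apply norm_plus_le|].
      eapply Rle_trans; [apply Rplus_le_compat; apply norm_plus_le|]; lra.
    - intros s1 t1 Hs1 Ht1 Hedge; specialize (Hbdry s1 t1 Hs1 Ht1 Hedge).
      replace (g (s1, t1)) with (minus (g (s1, t1)) (scal (RtoC k) zero))
        by (vector; ring).
      apply Hgk; [assumption|]; intros r Hr.
      apply Rle_trans with (norm (f (s1 + r, t1))); [right; f_equal; vector; ring|].
      apply Rle_trans with (1 := norm_le_minus (f (s1 + r, t1)) (f (s1, t1))).
      exact (Rplus_le_compat _ _ _ _ Hbdry (Hshift s1 t1 r Hs1 Ht1 Hr)). }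
  assert (Hdiff := Hgk s t (f (s, t)) (eps / 2) Ht (fun r Hr => Hshift s t r Hs Ht Hr)).
  assert (Hk2 : k * norm (f (s, t)) <= k * (M + eps)).
  { rewrite <- norm_scal_pos by assumption.
    replace (scal (RtoC k) (f (s, t))) with
      (minus (g (s, t)) (minus (g (s, t)) (scal (RtoC k) (f (s, t)))))
      by (vector; ring).
    apply Rle_trans with (1 := norm_minus_le _ _); lra. }
  now apply Rmult_le_reg_l with k.
Qed.

(** * The complex exponential *)

(** Defined by its polar form, which is the form in which the points of the half-plane
    are given. *)
Definition cexp (z : C) : C := (exp (Re z) * cos (Im z), exp (Re z) * sin (Im z)).

Lemma cexp_plus (z w : C) : cexp (z + w) = (cexp z * cexp w)%C.
Proof.
  destruct z as [a b], w as [c d]; unfold cexp; simpl.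
  apply injective_projections; simpl;
    rewrite exp_plus, ?cos_plus, ?sin_plus; ring.
Qed.

Lemma cexp_opp_l (z : C) : (cexp (- z) * cexp z)%C = 1%C.
Proof.
  rewrite <- cexp_plus; replace (- z + z)%C with (RtoC 0) by ring.
  unfold cexp; simpl; rewrite exp_0, cos_0, sin_0.
  apply injective_projections; simpl; ring.
Qed.

Lemma Cmod_cexp (z : C) : Cmod (cexp z) = exp (Re z).
Proof.
  unfold Cmod, cexp; simpl.
  replace (_ + _) with (Rsqr (exp (Re z)) * (Rsqr (sin (Im z)) + Rsqr (cos (Im z))))
    by (unfold Rsqr; ring).
  rewrite sin2_cos2, Rmult_1_r; apply sqrt_Rsqr; left; apply exp_pos.
Qed.

Lemma derivable_pt_lim_0 (f : R -> R) (l : R) :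
  derivable_pt_lim f 0 l -> forall eps, 0 < eps ->
  exists delta, 0 < delta /\ forall h, Rabs h < delta ->
    Rabs (f h - f 0 - l * h) <= eps * Rabs h.
Proof.
  intros Hf eps Heps; destruct (Hf eps Heps) as [d Hd].
  exists d; split; [apply cond_pos|]; intros h Hh.
  destruct (Req_dec h 0) as [->|Hne].
  - replace (f 0 - f 0 - l * 0) with 0 by ring; rewrite Rabs_R0; lra.
  - specialize (Hd h Hne Hh); rewrite Rplus_0_l in Hd.
    replace (f h - f 0 - l * h) with (((f h - f 0) / h - l) * h) by (field; assumption).
    rewrite Rabs_mult; apply Rmult_le_compat_r; [apply Rabs_pos|lra].
Qed.

(** The real and imaginary parts are expanded separately, from the derivatives at zero of
    the real exponential, cosine and sine. *)
Lemma cexp_first_order_0 (eps : R) :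
  0 < eps -> exists delta, 0 < delta /\ forall h : C, Cmod h < delta ->
    Cmod (cexp h - 1 - h) <= eps * Cmod h.
Proof.
  intros Heps; set (eta := Rmin (eps / 6) 1).
  assert (Heta : 0 < eta) by (apply Rmin_pos; lra).
  assert (Heta1 : eta <= eps / 6) by apply Rmin_l.
  assert (Heta2 : eta <= 1) by apply Rmin_r.
  destruct (derivable_pt_lim_0 _ _ derivable_pt_lim_exp_0 eta Heta) as (d1 & Hd1 & He).
  destruct (derivable_pt_lim_0 _ _ (derivable_pt_lim_cos 0) eta Heta) as (d2 & Hd2 & Hc).
  destruct (derivable_pt_lim_0 _ _ (derivable_pt_lim_sin 0) eta Heta) as (d3 & Hd3 & Hs).
  rewrite exp_0 in He; rewrite cos_0, sin_0 in Hc; rewrite sin_0, cos_0 in Hs.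
  exists (Rmin (Rmin d1 d2) (Rmin d3 (eta / 2))); split.
  { repeat apply Rmin_pos; lra. }
  intros h Hh.
  assert (R1 := Rlt_le_trans _ _ _ Hh (Rmin_l _ _)).
  assert (R2 := Rlt_le_trans _ _ _ Hh (Rmin_r _ _)).
  assert (H1 := Rlt_le_trans _ _ _ R1 (Rmin_l _ _)).
  assert (H2 := Rlt_le_trans _ _ _ R1 (Rmin_r _ _)).
  assert (H3 := Rlt_le_trans _ _ _ R2 (Rmin_l _ _)).
  assert (H4 := Rlt_le_trans _ _ _ R2 (Rmin_r _ _)).
  assert (Ha := Rle_trans _ _ _ (Rmax_l _ _) (Rmax_Cmod h)).
  assert (Hb := Rle_trans _ _ _ (Rmax_r _ _) (Rmax_Cmod h)).
  destruct h as [a b]; simpl fst in Ha; simpl snd in Hb.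
  set (m := Cmod (a, b)) in *.
  specialize (He a ltac:(lra)); specialize (Hc b ltac:(lra)); specialize (Hs b ltac:(lra)).
  assert (Pa := Rabs_pos a); assert (Pb := Rabs_pos b).
  assert (Ea : Rabs (exp a - 1) <= eta).
  { replace (exp a - 1) with ((exp a - 1 - 1 * a) + a) by ring.
    apply Rle_trans with (1 := Rabs_triang _ _); nra. }
  assert (Ex : exp a <= 2).
  { assert (Hx := Rle_abs (exp a - 1)); lra. }
  assert (Sb : Rabs (sin b) <= 2 * m).
  { replace (sin b) with ((sin b - 0 - 1 * b) + b) by ring.
    apply Rle_trans with (1 := Rabs_triang _ _); nra. }
  apply Rle_trans with (1 := Cmod_le_sum _); simpl.
  apply Rle_trans with ((eta * m + 2 * (eta * m)) + (eta * (2 * m) + eta * m)); [|nra].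
  apply Rplus_le_compat.
  - replace (exp a * cos b + - (1) + - a)
      with ((exp a - 1 - 1 * a) + exp a * (cos b - 1 - - (0) * b)) by ring.
    apply Rle_trans with (1 := Rabs_triang _ _); rewrite Rabs_mult.
    rewrite (Rabs_pos_eq (exp a)) by (left; apply exp_pos).
    apply Rplus_le_compat; [nra|].
    apply Rmult_le_compat; [left; apply exp_pos|apply Rabs_pos|assumption|nra].
  - replace (exp a * sin b + - (0) + - b)
      with ((exp a - 1) * sin b + (sin b - 0 - 1 * b)) by ring.
    apply Rle_trans with (1 := Rabs_triang _ _); rewrite Rabs_mult.
    apply Rplus_le_compat; [|nra].
    apply Rmult_le_compat; try apply Rabs_pos; assumption.
Qed.

Lemma is_derive_cexp (z : C) :
  is_derive (K := C_AbsRing) (V := AbsRing_NormedModule C_AbsRing) cexp z (cexp z).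
Proof.
  apply (first_order_derive (X := AbsRing_NormedModule C_AbsRing)).
  intros eps Heps; assert (Hz := exp_pos (Re z)).
  destruct (cexp_first_order_0 (eps / exp (Re z))) as (d & Hd & H0).
  { now apply Rdiv_lt_0_compat. }
  exists d; split; [assumption|]; intros w Hw.
  change (Cmod (cexp w - cexp z - (w - z) * cexp z) <= eps * Cmod (w - z)).
  replace (cexp w - cexp z - (w - z) * cexp z)%C
    with (cexp z * (cexp (w - z) - 1 - (w - z)))%C.
  - rewrite Cmod_mult, Cmod_cexp.
    apply Rle_trans with (exp (Re z) * (eps / exp (Re z) * Cmod (w - z))).
    + apply Rmult_le_compat_l; [lra|auto].
    + right; field; lra.
  - assert (E : cexp w = (cexp z * cexp (w - z))%C)
      by (rewrite <- cexp_plus; f_equal; ring).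
    rewrite E; ring.
Qed.

Lemma is_derive_quadratic (c0 c1 c2 z : C) :
  is_derive (K := C_AbsRing) (V := AbsRing_NormedModule C_AbsRing)
    (fun w => c0 + c1 * w + c2 * (w * w))%C z (c1 + 2 * c2 * z)%C.
Proof.
  apply (first_order_derive (X := AbsRing_NormedModule C_AbsRing)).
  intros eps Heps; assert (Hc := Cmod_ge_0 c2).
  exists (eps / (Cmod c2 + 1)); split; [apply Rdiv_lt_0_compat; lra|]; intros w Hw.
  change (Cmod ((c0 + c1 * w + c2 * (w * w)) - (c0 + c1 * z + c2 * (z * z))
                - (w - z) * (c1 + 2 * c2 * z)) <= eps * Cmod (w - z)).
  replace ((c0 + c1 * w + c2 * (w * w)) - (c0 + c1 * z + c2 * (z * z))
                - (w - z) * (c1 + 2 * c2 * z))%C with (c2 * (w - z) * (w - z))%C by ring.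
  rewrite !Cmod_mult; apply Rmult_le_compat_r; [apply Cmod_ge_0|].
  apply Rmult_lt_compat_r with (r := Cmod c2 + 1) in Hw; [|lra].
  replace (eps / (Cmod c2 + 1) * (Cmod c2 + 1)) with eps in Hw by (field; lra).
  assert (Hm := Cmod_ge_0 (w - z)); lra.
Qed.

Lemma ex_derive_scal_fct {X : CompleteNormedModule C_AbsRing} (phi : C -> C) (g : C -> X)
    (z : C) :
  ex_derive (K := C_AbsRing) (V := AbsRing_NormedModule C_AbsRing) phi z ->
  ex_derive (K := C_AbsRing) g z ->
  ex_derive (K := C_AbsRing) (fun w => scal (phi w) (g w)) z.
Proof.
  intros [dphi Hphi] [dg Hg].
  exists (plus (scal dphi (g z)) (scal (phi z) dg)).
  unfold is_derive; eapply filterdiff_ext_lin.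
  - exact (filterdiff_scal_fct (K := C_AbsRing) (U := AbsRing_NormedModule C_AbsRing)
      (V := X) z phi g _ _ Cmult_comm Hphi Hg).
  - intros y; simpl.
    change (plus (scal (y * dphi)%C (g z)) (scal (phi z) (scal y dg))
            = scal y (plus (scal dphi (g z)) (scal (phi z) dg))).
    vector; ring.
Qed.

Lemma ex_derive_cexp_quadratic (c0 c1 c2 z : C) :
  ex_derive (K := C_AbsRing) (V := AbsRing_NormedModule C_AbsRing)
    (fun w => cexp (c0 + c1 * w + c2 * (w * w)))%C z.
Proof.
  eexists.
  apply (is_derive_comp (K := C_AbsRing) (V := AbsRing_NormedModule C_AbsRing) cexp
           (fun w => c0 + c1 * w + c2 * (w * w))%C).
  - apply is_derive_cexp.
  - apply is_derive_quadratic.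
Qed.

(** * The three lines lemma on a strip *)

(** [kappa] is chosen so that the exponential is at most [1 + eps / (B + 1)]. *)
Lemma le_exp_small (x B c : R) :
  0 <= B -> 0 <= c -> (forall kappa, 0 < kappa -> x <= B * exp (kappa * c)) -> x <= B.
Proof.
  intros HB Hc Hx; apply le_epsilon; intros eps Heps.
  set (e := eps / (B + 1)).
  assert (He : 0 < e) by (apply Rdiv_lt_0_compat; lra).
  assert (Hln : 0 < ln (1 + e)) by (rewrite <- ln_1; apply ln_increasing; lra).
  apply Rle_trans with (1 := Hx (ln (1 + e) / (c + 1)) ltac:(apply Rdiv_lt_0_compat; lra)).
  apply Rle_trans with (B * (1 + e)).
  - apply Rmult_le_compat_l; [assumption|].
    rewrite <- (exp_ln (1 + e)) at 2 by lra.
    destruct (Rle_lt_or_eq_dec (ln (1 + e) / (c + 1) * c) (ln (1 + e))) as [Hlt|Heq].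
    + apply Rmult_le_reg_r with (c + 1); [lra|].
      replace (ln (1 + e) / (c + 1) * c * (c + 1)) with (ln (1 + e) * c) by (field; lra).
      nra.
    + left; now apply exp_increasing.
    + rewrite Heq; lra.
  - assert (Hp : eps = e * (B + 1)) by (unfold e; field; lra); nra.
Qed.

Lemma exp_le (x y : R) : x <= y -> exp x <= exp y.
Proof. intros [H|H]; [left; now apply exp_increasing|rewrite H; lra]. Qed.

(** The function [(1 - phi / g) (L + d s)] of [s + i phi] is the real part of the quadratic
    polynomial [L + d w + i L w / g + i d w ^ 2 / (2 g)]. Dividing [G] by its exponential
    makes both boundary bounds equal to [A], and a factor [exp (- kappa w ^ 2)] makes the
    quotient small far out, so that the maximum principle applies on a long rectangle.
    Finally [kappa] tends to zero. The number [g] may be negative: the strip then lies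
    below the real axis. *)
Lemma three_lines {X : CompleteNormedModule C_AbsRing} (G : C -> X) (H g A L d : R) :
  holomorphic_on X (strip H) G -> g <> 0 -> Rabs g < H -> 0 <= A ->
  (forall s phi, Rabs phi <= Rabs g -> norm (G (s, phi)) <= A) ->
  (forall s, norm (G (s, 0)) <= A * exp (L + d * s)) ->
  forall s t, 0 <= t <= 1 -> norm (G (s, t * g)) <= A * exp ((1 - t) * (L + d * s)).
Proof.
  intros HG Hg HgH HA Hall H0 s t Ht.
  apply (le_exp_small _ _ (s * s + g * g)).
  { apply Rmult_le_pos; [assumption|left; apply exp_pos]. }
  { nra. }
  intros kappa Hk.
  (* [q] is minus the interpolating polynomial, minus [kappa w ^ 2]. *)
  set (c0 := RtoC (- L)); set (c1 := (- d, - L / g) : C).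
  set (c2 := (- kappa, - d / (2 * g)) : C).
  set (q := fun w : C => (c0 + c1 * w + c2 * (w * w))%C).
  assert (Hq : forall s tau, Re (q (s, tau * g)) =
            - ((1 - tau) * (L + d * s)) - kappa * (s * s) + kappa * (tau * tau * (g * g))).
  { intros; unfold q, c0, c1, c2; simpl; field; assumption. }
  set (f := fun w => scal (cexp (q w)) (G w) : X).
  assert (Hf : holomorphic_on X (strip H) f).
  { intros z Hz; apply ex_derive_scal_fct; [|now apply HG].
    apply ex_derive_cexp_quadratic. }
  assert (Hfn : forall w, norm (f w) <= exp (Re (q w)) * norm (G w)).
  { intros w; unfold f; rewrite <- Cmod_cexp; apply norm_scal_le. }
  set (M := A * exp (kappa * (g * g))).
  assert (HM : norm (f (s, t * g)) <= M).
  { (* From [r0] on, [kappa r0 ^ 2] dominates the growth [|L| + |d| r0] of the exponent;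
       the last summand puts [s] inside the rectangle. *)
    set (r0 := (Rabs L + Rabs d) / kappa + 1 + Rabs s).
    assert (PL := Rabs_pos L); assert (Pd := Rabs_pos d); assert (Ps := Rabs_pos s).
    assert (Hr0 : Rabs L + Rabs d * r0 <= kappa * (r0 * r0)).
    { assert (Hr1 : Rabs L + Rabs d <= kappa * r0).
      { unfold r0; rewrite !Rmult_plus_distr_l.
        replace (kappa * ((Rabs L + Rabs d) / kappa)) with (Rabs L + Rabs d)
          by (field; lra).
        nra. }
      assert (Hr2 : 1 <= r0).
      { assert (Hq0 : 0 <= (Rabs L + Rabs d) / kappa).
        { apply Rmult_le_pos; [lra|left; now apply Rinv_0_lt_compat]. }
        unfold r0; lra. }
      nra. }
    assert (Hsr : - r0 <= s <= r0).
    { assert (Hq0 : 0 <= (Rabs L + Rabs d) / kappa).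
      { apply Rmult_le_pos; [lra|left; now apply Rinv_0_lt_compat]. }
      assert (S1 := Rle_abs s); assert (S2 := Rle_abs (- s)); rewrite Rabs_Ropp in S2.
      unfold r0; lra. }
    set (y0 := Rmin 0 g).
    assert (Hy : forall y, y0 <= y <= y0 + Rabs g ->
              exists tau, 0 <= tau <= 1 /\ y = tau * g).
    { intros y Hy; exists (y / g).
      assert (E : y = y / g * g) by (field; assumption).
      split; [|exact E]; unfold y0 in Hy.
      destruct (Rle_dec 0 g).
      - rewrite Rmin_left, Rabs_pos_eq in Hy by lra; nra.
      - rewrite Rmin_right, Rabs_left in Hy by lra; nra. }
    apply (maximum_principle f H (- r0) y0 (2 * r0) (Rabs g) M Hf).
    - unfold y0, Rmin; destruct (Rle_dec 0 g); [|assumption].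
      rewrite Rabs_R0; apply Rle_lt_trans with (2 := HgH); apply Rabs_pos.
    - unfold y0, Rmin; destruct (Rle_dec 0 g).
      + now rewrite Rplus_0_l, Rabs_Rabsolu.
      + rewrite (Rabs_left g) by lra; replace (g + - g) with 0 by ring.
        rewrite Rabs_R0; apply Rle_lt_trans with (2 := HgH); apply Rabs_pos.
    - lra.
    - apply Rabs_pos.
    - intros s1 y Hs1 Hyr Hedge.
      destruct (Hy y Hyr) as (tau & Htau & Hytau).
      assert (Hyg : Rabs y <= Rabs g).
      { rewrite Hytau, Rabs_mult, (Rabs_pos_eq tau) by lra.
        assert (Pg := Rabs_pos g); nra. }
      assert (Hgg : 0 < g * g) by nra.
      assert (Htt : tau * tau * (g * g) <= g * g).
      { assert (Hsq : tau * tau <= 1) by nra; nra. }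
      apply Rle_trans with (1 := Hfn _); rewrite Hytau, Hq.
      destruct (Req_dec tau 0) as [E0|N0]; [|destruct (Req_dec tau 1) as [E1|N1]].
      + subst tau; rewrite (Rmult_0_l g).
        apply Rle_trans with
          (exp (- ((1 - 0) * (L + d * s1)) - kappa * (s1 * s1) + kappa * (0 * 0 * (g * g)))
           * (A * exp (L + d * s1))).
        { apply Rmult_le_compat_l; [left; apply exp_pos|apply H0]. }
        unfold M; rewrite (Rmult_comm A), <- Rmult_assoc, <- exp_plus, Rmult_comm.
        apply Rmult_le_compat_l; [assumption|]; apply exp_le; nra.
      + subst tau; rewrite <- Hytau, Rmult_comm; unfold M.
        apply Rmult_le_compat; [apply (norm_ge_0 (V := X))|left; apply exp_pos| |].
        * now apply Hall.
        * apply exp_le; nra.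
      + (* A point strictly between the horizontal sides lies on a vertical one. *)
        assert (Hs1e : Rabs s1 = r0).
        { destruct Hedge as [->|[->|[Ey|Ey]]].
          - rewrite Rabs_Ropp, Rabs_pos_eq; lra.
          - replace (- r0 + 2 * r0) with r0 by ring; rewrite Rabs_pos_eq; lra.
          - exfalso; unfold y0 in Ey; rewrite Ey in Hytau.
            unfold Rmin in Hytau; destruct (Rle_dec 0 g); [apply N0|apply N1]; nra.
          - exfalso; unfold y0 in Ey; rewrite Ey in Hytau.
            unfold Rmin in Hytau; destruct (Rle_dec 0 g).
            + rewrite Rabs_pos_eq in Hytau by lra; apply N1; nra.
            + rewrite Rabs_left in Hytau by lra; apply N0; nra. }
        rewrite <- Hytau, Rmult_comm; unfold M.
        apply Rmult_le_compat; [apply (norm_ge_0 (V := X))|left; apply exp_pos| |].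
        * now apply Hall.
        * apply exp_le.
          assert (Hsq : s1 * s1 = r0 * r0).
          { rewrite <- Hs1e; unfold Rabs; destruct (Rcase_abs s1); ring. }
          assert (Hlin : - ((1 - tau) * (L + d * s1)) <= Rabs L + Rabs d * r0).
          { rewrite <- Hs1e, <- Rabs_mult.
            apply Rle_trans with (1 := Rle_abs _); rewrite Rabs_Ropp, Rabs_mult.
            rewrite (Rabs_pos_eq (1 - tau)) by lra.
            assert (T := Rabs_triang L (d * s1)); assert (P := Rabs_pos (L + d * s1)).
            nra. }
          rewrite Hsq; nra.
    - lra.
    - unfold y0, Rmin; destruct (Rle_dec 0 g).
      + rewrite (Rabs_pos_eq g) by lra; nra.
      + rewrite (Rabs_left g) by lra; nra. }
  assert (Hz := Hq s t); set (z := (s, t * g) : C) in *.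
  replace (G z) with (scal (cexp (- q z)%C) (f z)).
  - apply Rle_trans with (1 := norm_scal_le _ _); rewrite Cmod_cexp.
    apply Rle_trans with (exp (Re (- q z)) * M).
    + apply Rmult_le_compat_l; [left; apply exp_pos|assumption].
    + change (Re (- q z)) with (- Re (q z)); rewrite Hz; unfold M.
      rewrite (Rmult_comm _ (A * _)), !Rmult_assoc, <- !exp_plus.
      apply Rmult_le_compat_l; [assumption|]; apply exp_le.
      assert (Hgg : 0 <= kappa * (t * t * (g * g))) by (apply Rmult_le_pos; nra).
      lra.
  - unfold f; transitivity (scal (cexp (- q z) * cexp (q z))%C (G z)).
    + vector; ring.
    + rewrite cexp_opp_l; vector; ring.
Qed.

(** * Sectors of the half-plane *)

Lemma cos_Rabs (x : R) : cos (Rabs x) = cos x.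
Proof. unfold Rabs; destruct (Rcase_abs x); [apply cos_neg|reflexivity]. Qed.

(** Concavity: by the mean value theorem the slope of the chord of the sine from [0] to
    [eps y] is at least that from [eps y] to [y]. *)
Lemma sin_scaling (eps y : R) :
  0 < eps < 1 -> 0 < y <= PI / 2 -> eps * sin y <= sin (eps * y).
Proof.
  intros Heps Hy; assert (Hpi := PI_RGT_0).
  destruct (MVT_cor2 sin cos 0 (eps * y)) as (c1 & E1 & Hc1);
    [nra|intros; apply derivable_pt_lim_sin|].
  destruct (MVT_cor2 sin cos (eps * y) y) as (c2 & E2 & Hc2);
    [nra|intros; apply derivable_pt_lim_sin|].
  assert (Hcos : cos c2 <= cos c1) by (apply cos_decr_1; lra).
  rewrite sin_0 in E1.
  assert (Hp : 0 <= eps * y * (1 - eps) * (cos c1 - cos c2))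
    by (repeat apply Rmult_le_pos; lra).
  nra.
Qed.

(** The angle from the ray at [gamma eps theta] to the imaginary axis is [eps] times the
    angle from the ray at [theta]. *)
Lemma cos_gamma_ge (eps theta : R) :
  0 < eps < 1 -> Rabs theta < PI / 2 -> eps * cos theta <= cos (gamma eps theta).
Proof.
  intros Heps Htheta; assert (Hp := Rabs_pos theta).
  rewrite <- (cos_Rabs theta), <- (sin_shift (Rabs theta)), <- (sin_shift (gamma eps theta)).
  replace (PI / 2 - gamma eps theta) with (eps * (PI / 2 - Rabs theta))
    by (unfold gamma; ring).
  apply sin_scaling; lra.
Qed.

Lemma cexp_polar (s phi : R) : cexp (s, phi) = polar (exp s) phi.
Proof. apply injective_projections; simpl; ring. Qed.

Lemma Rpower_opp_anti (x y b : R) :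
  0 <= b -> 0 < x <= y -> Rpower y (- b) <= Rpower x (- b).
Proof.
  intros Hb [Hx Hxy]; unfold Rpower; apply exp_le.
  assert (Hln : ln x <= ln y) by (destruct Hxy as [H|<-]; [left; now apply ln_increasing|lra]).
  nra.
Qed.

(** In the coordinate [w = ln z] the sector between the angles [0] and [g] becomes a strip,
    and [F (exp w) exp (b w)] is bounded there by [a (cos g) ^ (- b)], because the cosine
    is smallest on the outer ray. On the real axis the better bound gains the factor
    [exp (L + d ln r)], and the three lines lemma interpolates. *)
Lemma sector_interpolation {X : CompleteNormedModule C_AbsRing} (F : C -> X)
    (a b L d g : R) :
  holomorphic_on X right_half_plane F -> 0 < a -> 0 <= b ->
  g <> 0 -> Rabs g < PI / 2 ->
  (forall r theta, 0 < r -> Rabs theta < PI / 2 ->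
     norm (F (polar r theta)) <= a * Rpower (r * cos theta) (- b)) ->
  (forall r, 0 < r -> norm (F (RtoC r)) <= a * Rpower r (- b) * exp (L + d * ln r)) ->
  forall r t, 0 < r -> 0 <= t <= 1 ->
    norm (F (polar r (t * g))) <=
      a * Rpower (r * cos g) (- b) * exp ((1 - t) * (L + d * ln r)).
Proof.
  intros HF Ha Hb Hg HgP Hsec Hre r t Hr Ht.
  assert (Hcos : forall phi, Rabs phi < PI / 2 -> 0 < cos phi).
  { intros phi Hphi; apply Rabs_def2 in Hphi; apply cos_gt_0; lra. }
  set (mult := fun w : C => cexp (0 + RtoC b * w + 0 * (w * w))%C).
  set (G := fun w => scal (mult w) (F (cexp w)) : X).
  assert (HG : holomorphic_on X (strip (PI / 2)) G).
  { intros w Hw; apply ex_derive_scal_fct; [apply ex_derive_cexp_quadratic|].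
    assert (Hdom : right_half_plane (cexp w)).
    { apply Rmult_lt_0_compat; [apply exp_pos|now apply Hcos]. }
    destruct (HF _ Hdom) as [l Hl]; eexists.
    exact (is_derive_comp (K := C_AbsRing) (V := X) F cexp w l _ Hl (is_derive_cexp w)). }
  assert (Hmult : forall s phi, Cmod (mult (s, phi)) = exp (b * s)).
  { intros; unfold mult; rewrite Cmod_cexp; f_equal; simpl; ring. }
  set (A := a * Rpower (cos g) (- b)).
  assert (HA : 0 <= A) by (apply Rmult_le_pos; [lra|left; apply exp_pos]).
  assert (Hcg : 0 < cos g <= 1) by (split; [now apply Hcos|apply COS_bound]).
  assert (Hprod : forall s c, 0 < c ->
            exp (b * s) * (a * Rpower (exp s * c) (- b)) = a * Rpower c (- b)).
  { intros s c Hc; unfold Rpower.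
    rewrite ln_mult, ln_exp by (auto; apply exp_pos).
    replace (- b * (s + ln c)) with (- (b * s) + - b * ln c) by ring.
    rewrite exp_plus, exp_Ropp; field; apply Rgt_not_eq, exp_pos. }
  assert (Hmain := three_lines G (PI / 2) g A L d HG Hg HgP HA).
  specialize (fun H1 H2 => Hmain H1 H2 (ln r) t Ht).
  assert (HGle : norm (G (ln r, t * g)) <= A * exp ((1 - t) * (L + d * ln r))).
  { apply Hmain.
    - intros s phi Hphi; unfold G.
      apply Rle_trans with (1 := norm_scal_le _ _); rewrite Hmult, cexp_polar.
      assert (Hphi2 : Rabs phi < PI / 2) by lra.
      apply Rle_trans with (exp (b * s) * (a * Rpower (exp s * cos phi) (- b))).
      + apply Rmult_le_compat_l; [left; apply exp_pos|].
        apply Hsec; [apply exp_pos|assumption].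
      + rewrite Hprod by auto; unfold A; apply Rmult_le_compat_l; [lra|].
        apply Rpower_opp_anti; [assumption|]; split; [lra|].
        rewrite <- (cos_Rabs g), <- (cos_Rabs phi).
        assert (P1 := Rabs_pos phi); apply cos_decr_1; lra.
    - intros s; unfold G.
      apply Rle_trans with (1 := norm_scal_le _ _); rewrite Hmult.
      replace (cexp (s, 0)) with (RtoC (exp s)).
      2: { apply injective_projections; simpl; rewrite ?cos_0, ?sin_0; ring. }
      apply Rle_trans with
        (exp (b * s) * (a * Rpower (exp s * 1) (- b) * exp (L + d * s))).
      + apply Rmult_le_compat_l; [left; apply exp_pos|].
        rewrite Rmult_1_r; rewrite <- (ln_exp s) at 3; apply Hre, exp_pos.
      + rewrite <- Rmult_assoc, Hprod by lra.
        apply Rmult_le_compat_r; [left; apply exp_pos|].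
        apply Rmult_le_compat_l; [lra|]; apply Rpower_opp_anti; assumption. }
  set (w := (ln r, t * g) : C) in *.
  assert (Hw : cexp w = polar r (t * g)).
  { unfold w; now rewrite cexp_polar, exp_ln. }
  rewrite <- Hw.
  replace (F (cexp w)) with (scal (cexp (- (0 + RtoC b * w + 0 * (w * w)))%C) (G w)).
  - apply Rle_trans with (1 := norm_scal_le _ _); rewrite Cmod_cexp.
    replace (Re (- (0 + RtoC b * w + 0 * (w * w)))) with (- b * ln r)
      by (unfold w; simpl; ring).
    apply Rle_trans with (exp (- b * ln r) * (A * exp ((1 - t) * (L + d * ln r)))).
    + apply Rmult_le_compat_l; [left; apply exp_pos|assumption].
    + right; unfold A; rewrite <- Rpower_mult_distr by lra; unfold Rpower.
      ring.
  - unfold G; transitivity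
      (scal (cexp (- (0 + RtoC b * w + 0 * (w * w))) * mult w)%C (F (cexp w))).
    + vector; ring.
    + unfold mult; rewrite cexp_opp_l; vector; ring.
Qed.

Theorem theorem2p1
  (X : CompleteNormedModule C_AbsRing) (F : C -> X)
  (HF : holomorphic_on X right_half_plane F)
  (a1 a2 a3 beta1 beta2 beta3 : R)
  (Ha1 : 0 < a1) (Ha2 : 0 < a2) (Ha3 : 0 < a3)
  (Hb1 : 0 <= beta1) (Hb2 : 0 <= beta2) (Hb3 : 0 <= beta3)
  (Hsector : forall r theta : R, 0 < r -> Rabs theta < PI / 2 ->
     norm (F (polar r theta)) <= a1 * Rpower (r * cos theta) (- beta1))
  (Hreal : forall r : R, 0 < r ->
     norm (F (RtoC r)) <=
       a1 * Rpower r (- beta1)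
          * Rpower (a2 / r) (- beta2) * Rpower (a3 / r) beta3) :
  forall eps r theta : R,
    0 < eps < 1 -> 0 < r -> Rabs theta < PI / 2 ->
    norm (F (polar r theta)) <=
      a1 * Rpower (r * cos theta) (- beta1)
         * Rmin 1 (Rpower eps (- beta1)
                   * Rpower (Rpower (a2 / r) (- beta2) * Rpower (a3 / r) beta3)
                            (1 - Rabs theta / gamma eps theta)).
Proof.
  intros eps r theta Heps Hr Htheta.
  set (P := Rpower (r * cos theta) (- beta1)).
  set (L := - beta2 * ln a2 + beta3 * ln a3); set (d := beta2 - beta3).
  assert (Hbracket : forall r, 0 < r ->
            Rpower (a2 / r) (- beta2) * Rpower (a3 / r) beta3 = exp (L + d * ln r)).
  { intros x Hx; unfold Rpower; rewrite !ln_div, <- exp_plus by assumption.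
    f_equal; unfold L, d; ring. }
  rewrite Hbracket by assumption.
  assert (Hpow : forall c, Rpower (exp (L + d * ln r)) c = exp (c * (L + d * ln r))).
  { intros c; unfold Rpower; now rewrite ln_exp. }
  rewrite Hpow.
  assert (Hpi := PI_RGT_0); assert (Habs := Rabs_pos theta).
  set (gam := gamma eps theta).
  assert (Hgam : Rabs theta < gam < PI / 2 /\ 0 < gam) by (unfold gam, gamma; nra).
  assert (Hc : 0 < cos theta) by (apply Rabs_def2 in Htheta; apply cos_gt_0; lra).
  assert (HP : 0 <= a1 * P) by (apply Rmult_le_pos; [lra|left; apply exp_pos]).
  assert (Hinterp : norm (F (polar r theta)) <=
            a1 * P * (Rpower eps (- beta1)
                      * exp ((1 - Rabs theta / gam) * (L + d * ln r)))).
  { (* The outer ray of the sector is taken on the side of [theta]. *)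
    set (g := if Rle_dec 0 theta then gam else - gam).
    assert (Hg : g <> 0) by (unfold g; destruct (Rle_dec 0 theta); lra).
    assert (Hgabs : Rabs g = gam).
    { unfold g; destruct (Rle_dec 0 theta); rewrite ?Rabs_Ropp; apply Rabs_pos_eq; lra. }
    assert (Hcosg : cos g = cos gam).
    { unfold g; destruct (Rle_dec 0 theta); [reflexivity|apply cos_neg]. }
    set (t := Rabs theta / gam).
    assert (Ht : 0 <= t <= 1).
    { assert (E : t * gam = Rabs theta) by (unfold t; field; lra); nra. }
    assert (Htg : t * g = theta).
    { unfold t, g; destruct (Rle_dec 0 theta) as [H|H].
      - rewrite Rabs_pos_eq by assumption; field; lra.
      - rewrite Rabs_left by lra; field; lra. }
    rewrite <- Htg at 1.
    apply Rle_trans with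
      (a1 * Rpower (r * cos g) (- beta1) * exp ((1 - t) * (L + d * ln r))).
    - apply sector_interpolation; auto; [rewrite Hgabs; lra|].
      intros x Hx; apply Rle_trans with (1 := Hreal x Hx).
      rewrite <- Hbracket by assumption; lra.
    - rewrite <- Rmult_assoc; apply Rmult_le_compat_r; [left; apply exp_pos|].
      rewrite Rmult_assoc; apply Rmult_le_compat_l; [lra|]; unfold P.
      rewrite Rpower_mult_distr by (try apply Rmult_lt_0_compat; lra).
      apply Rpower_opp_anti; [assumption|].
      assert (Hge := cos_gamma_ge eps theta Heps Htheta); fold gam in Hge.
      rewrite Hcosg; split; [repeat apply Rmult_lt_0_compat; lra|].
      replace (r * cos theta * eps) with (r * (eps * cos theta)) by ring.
      apply Rmult_le_compat_l; lra. }
  unfold Rmin; destruct (Rle_dec _ _); [rewrite Rmult_1_r; now apply Hsector|assumption].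
Qed.
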